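(* Any non-invertible planar graph $(\Gamma,\prec)$ with $n$ real vertices can be written (up to isomorphism of planar graphs) as a composition $(\Gamma_n,\prec_n)\circ\cdots\circ(\Gamma_1,\prec_1)$ of planar graphs in which each $(\Gamma_k,\prec_k)$, $1\le k\le n$, is essential prime.
   Context: A graph is a triple $(H,P,\sigma)$ with $H$ a finite set (half-edges), $P$ a partition of $H$ into nonempty blocks (vertices), $\sigma$ an involution of $H$ (its orbits are the edges), such that a vertex containing a two-element $\sigma$-orbit equals that orbit; such vertices and edges are called virtual, all other vertices real. A leg is a half-edge fixed by $\sigma$ (real leg) or lying in a virtual edge (virtual leg). An orientation $\mathrm{sgn}:H\to\{+,-\}$ takes different values on the two elements of each two-element orbit; $In(v),Out(v)$ (resp. $In(\Gamma),Out(\Gamma)$) are the sets of half-edges in $v$ (resp. of legs) of sign $+$, $-$. The graph is directed if all $In(v),Out(v)$ are nonempty. The source (target) of an edge is the vertex containing its $-$ ($+$) half-edge, if there is one; $e\to e'$ means there are edges $e=e_1,\dots,e_n=e'$, $n\ge 1$, with the target of $e_i$ equal to the source of $e_{i+1}$. A planar graph is a directed graph with a linear order $\prec$ on its set of edges such that for all distinct edges: $e_1\to e_2$ implies $e_1\prec e_2$; and if $e_1\to e_2$ and $e_1\prec e_3\prec e_2$ then $e_1\to e_3$ or $e_3\to e_2$. $In(\Gamma)$, $Out(\Gamma)$ are ordered by $\prec$ applied to the edges containing the legs. Isomorphisms are bijections of half-edges preserving all the structure. A graph is unitary if it consists of exactly one virtual vertex (two half-edges); prime if it has exactly one vertex and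 is not unitary. The tensor product of graphs is disjoint union. A graph is elementary if it is a tensor product of finitely many prime and unitary graphs, essential prime if it is elementary with exactly one real vertex, invertible if it is a tensor product of finitely many (possibly zero) unitary graphs; a planar graph has one of these properties if its underlying graph does. Composition: let $Out(\Gamma_1)=\{o_1,\dots,o_n\}$ and $In(\Gamma_2)=\{i_1,\dots,i_n\}$ in increasing order. $\Gamma_2\circ\Gamma_1$ is obtained from the disjoint union by grafting $o_k$ to $i_k$ for each $k$: if both are real legs, join them into an edge $\bar e_k=\{o_k,i_k\}$; if exactly one is virtual, delete its virtual edge, the edge of the other being $\bar e_k$; if both are virtual, delete $o_k,i_k$ and let $\bar e_k=\{\sigma_1(o_k),\sigma_2(i_k)\}$ be a virtual edge (and a virtual vertex). The order on edges is $A_1,\bar e_1,B_1,\dots,A_n,\bar e_n,B_n$, where $A_k$ is the set of edges of $\Gamma_1$ strictly between the edges of $o_{k-1}$ and $o_k$ (before that of $o_1$ if $k=1$) and $B_k$ the set of edges of $\Gamma_2$ strictly between the edges of $i_k$ and $i_{k+1}$ (after that of $i_n$ if $k=n$), each with its own order. *)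

(* Defs.v *)
From mathcomp Require Import all_boot.

Set Implicit Arguments.
Unset Strict Implicit.
Unset Printing Implicit Defensive.

(* The records below carry data only; the axioms are the predicates [is_graph] *)
(* and [is_planar].  [inv] is the involution sigma.                            *)
Record graph := Graph {
  half : finType;
  vertices : {set {set half}};
  inv : half -> half }.

Section GraphTheory.
Variable G : graph.
Implicit Types (h : half G) (v : {set half G}).

Definition edge h : {set half G} := [set h; inv h].

Definition edges : {set {set half G}} := [set edge h | h : half G].

Definition is_graph : Prop :=
  [/\ partition (vertices G) [set: half G],
      involutive (@inv G)
    & forall v h, v \in vertices G -> h \in v -> inv h \in v -> inv h != h ->
        v = edge h].

Definition virtual_vertex v : bool :=
  (v \in vertices G) && [exists h, (inv h != h) && (v == edge h)].

Definition real_vertices : {set {set half G}} :=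
  [set v in vertices G | ~~ virtual_vertex v].

Definition real_leg h : bool := inv h == h.

Definition virtual_leg h : bool := (inv h != h) && (edge h \in vertices G).

Definition leg h : bool := real_leg h || virtual_leg h.

Definition unitary : Prop :=
  exists v, virtual_vertex v /\ vertices G = [set v].

Definition prime_graph : Prop := #|vertices G| = 1 /\ ~ unitary.

End GraphTheory.

Definition graph_iso (G1 G2 : graph) (f : half G1 -> half G2) : Prop :=
  [/\ bijective f,
      {morph f : h / inv h}
    & forall v : {set half G1}, (f @: v \in vertices G2) = (v \in vertices G1)].

Definition empty_graph : graph := @Graph void set0 id.

Definition tensor (G1 G2 : graph) : graph :=
  @Graph (half G1 + half G2)%type
    ([set inl @: (v : {set half G1}) | v in vertices G1] :|:
     [set inr @: (v : {set half G2}) | v in vertices G2])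
    (fun x => match x with inl h => inl (inv h) | inr h => inr (inv h) end).

Definition tensor_of (C : graph -> Prop) (G : graph) : Prop :=
  exists (Gs : seq graph) (f : half G -> half (foldr tensor empty_graph Gs)),
    (forall k, k < size Gs ->
       is_graph (nth empty_graph Gs k) /\ C (nth empty_graph Gs k)) /\
    graph_iso f.

Definition elementary : graph -> Prop :=
  tensor_of (fun G => prime_graph G \/ unitary G).

Definition essential_prime (G : graph) : Prop :=
  elementary G /\ #|real_vertices G| = 1.

Definition invertible : graph -> Prop := tensor_of unitary.

(* [sgn h = true] stands for the sign +.  Only the restriction of [prec] to    *)
(* [edges] is meaningful.                                                      *)
Record pgraph := PGraph {
  ugraph :> graph;
  sgn : half ugraph -> bool;
  prec : rel {set half ugraph} }.

Section Planar.
Variable G : pgraph.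
Implicit Types (h : half G) (v e : {set half G}).

Definition vIn v : {set half G} := [set h in v | sgn h].
Definition vOut v : {set half G} := [set h in v | ~~ sgn h].
Definition gIn : {set half G} := [set h | leg h & sgn h].
Definition gOut : {set half G} := [set h | leg h & ~~ sgn h].

Definition is_directed : Prop :=
  (forall h, inv h != h -> sgn (inv h) = ~~ sgn h) /\
  (forall v, v \in vertices G -> vIn v != set0 /\ vOut v != set0).

Definition is_source v e : bool :=
  (v \in vertices G) && [exists h, [&& h \in e, ~~ sgn h & h \in v]].

Definition is_target v e : bool :=
  (v \in vertices G) && [exists h, [&& h \in e, sgn h & h \in v]].

Definition follows : rel {set half G} := fun e e' =>
  [&& e \in edges G, e' \in edges G & [exists v, is_target v e && is_source v e']].

Definition reaches : rel {set half G} := connect follows.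

Definition linear_on_edges : Prop :=
  [/\ {in edges G, irreflexive (@prec G)},
      {in edges G & &, transitive (@prec G)}
    & {in edges G &, forall e e', e != e' -> prec e e' || prec e' e}].

Definition is_planar : Prop :=
  [/\ is_graph G, is_directed, linear_on_edges,
      {in edges G &, forall e1 e2, e1 != e2 -> reaches e1 e2 -> prec e1 e2}
    & {in edges G & &, forall e1 e2 e3, reaches e1 e2 ->
         prec e1 e3 -> prec e3 e2 -> reaches e1 e3 || reaches e3 e2}].

(* If [e] contains the k-th element of [gOut] (resp. [gIn]), counting from 0   *)
(* in increasing order, its rank is k; otherwise it is the number of outgoing  *)
(* (resp. incoming) legs before [e].                                           *)
Definition out_rank e : nat := #|[set o in gOut | prec (edge o) e]|.
Definition in_rank e : nat := #|[set i in gIn | prec (edge i) e]|.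

End Planar.

Definition planar_iso (G1 G2 : pgraph) : Prop :=
  exists f : half G1 -> half G2,
    [/\ graph_iso f,
        forall h, sgn (f h) = sgn h
      & {in edges G1 &, forall e e' : {set half G1},
           prec (f @: e) (f @: e') = prec e e'}].

(* The composite [G2 o G1]; meaningful when [composable G1 G2] holds.          *)
Section Composition.
Variables G1 G2 : pgraph.
Implicit Types (h o : half G1) (g i : half G2).

Definition composable : Prop := #|gOut G1| = #|gIn G2|.

Definition grafted o i : bool :=
  [&& o \in gOut G1, i \in gIn G2 & out_rank (edge o) == in_rank (edge i)].

(* When both grafted legs are virtual only they are deleted; when exactly one  *)
(* is virtual its whole edge is.                                               *)
Definition deleted (x : half G1 + half G2) : bool :=
  match x with
  | inl h => [exists o, exists i, [&& grafted o i, virtual_leg o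
               & (h == o) || (h == inv o) && real_leg i]]
  | inr g => [exists o, exists i, [&& grafted o i, virtual_leg i
               & (g == i) || (g == inv i) && real_leg o]]
  end.

Definition comp_half : finType := {x : half G1 + half G2 | ~~ deleted x}.

(* The two half-edges of a newly created edge.                                 *)
Definition joined h g : bool :=
  [&& grafted h g, real_leg h & real_leg g] ||
  [&& grafted (inv h) (inv g), virtual_leg h & virtual_leg g].

Definition joined_inv (x : half G1 + half G2) : half G1 + half G2 :=
  match x with
  | inl h => if [pick g | joined h g] is Some g then inr g else inl (inv h)
  | inr g => if [pick h | joined h g] is Some h then inl h else inr (inv g)
  end.

(* [insubd] returns its default [x] only if [joined_inv] leaves [comp_half],   *)
(* which does not happen for composable planar graphs.                         *)
Definition comp_inv (x : comp_half) : comp_half := insubd x (joined_inv (val x)).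

(* A virtual edge of [G1] contains an outgoing leg and one of [G2] an incoming *)
(* leg, so each is deleted or replaced: the vertices are the old real ones and *)
(* the new virtual ones.                                                       *)
Definition comp_vertices : {set {set comp_half}} :=
  [set [set x : comp_half | val x \in inl @: (v : {set half G1})]
     | v in real_vertices G1] :|:
  [set [set x : comp_half | val x \in inr @: (v : {set half G2})]
     | v in real_vertices G2] :|:
  [set [set x; comp_inv x] | x in [set x : comp_half |
     [exists h, exists g,
        [&& val x == inl h, joined h g, virtual_leg h & virtual_leg g]]]].

Definition comp_graph : graph := Graph comp_vertices comp_inv.

Definition comp_sgn (x : comp_half) : bool :=
  match val x with inl h => sgn h | inr g => sgn g end.

(* The block containing the edge of [x]: for k >= 1 the blocks A_k, e_k, B_k   *)
(* are numbered 3 k - 2, 3 k - 1, 3 k.                                         *)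
Definition block (x : comp_half) : nat :=
  match val x with
  | inl h => if [exists o in gOut G1, edge o == edge h]
             then 3 * out_rank (edge h) + 2 else 3 * out_rank (edge h) + 1
  | inr g => if [exists i in gIn G2, edge i == edge g]
            then 3 * in_rank (edge g) + 2 else 3 * in_rank (edge g)
  end.

Definition half_prec (x y : comp_half) : bool :=
  (block x < block y) ||
  (block x == block y) &&
  match val x, val y with
  | inl h1, inl h2 => prec (edge h1) (edge h2)
  | inr h1, inr h2 => prec (edge h1) (edge h2)
  | _, _ => false
  end.

Definition comp_prec (e e' : {set comp_half}) : bool :=
  [exists x in e, exists y in e', half_prec x y].

Definition comp : pgraph := @PGraph comp_graph comp_sgn comp_prec.

End Composition.

(* [iterated_comp [:: G_1; ..; G_n] G]: [G] is [G_n o (.. o (G_2 o G_1))] and  *)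
(* every composite involved is defined.                                        *)
Inductive iterated_comp : seq pgraph -> pgraph -> Prop :=
| IterOne G : iterated_comp [:: G] G
| IterRcons Gs G G' :
    iterated_comp Gs G -> composable G G' -> iterated_comp (rcons Gs G') (comp G G').

(* Main.v *)
From mathcomp Require Import all_boot.
From mathcomp Require Import zify.
Require Import Defs.

(** A planar graph is determined up to isomorphism by its skeleton: the ordered
set of edges together with, for each edge, the real vertex it comes from and the
real vertex it goes to, whenever they exist.  A half-edge is then a pair of an
edge and a sign, and a virtual vertex is an edge with no real end.  A piece of a
skeleton is a set S of real vertices and a set A of edges containing all edges
incident to S; ends outside S are forgotten.  Saying that a planar graph
[realizes] a piece replaces equalities and isomorphisms of graphs throughout: a
piece has a realization ([model_realizes]), any two are isomorphic
([realizations_iso]), and a planar graph realizes its whole skeleton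
([planar_realizes]).

The decomposition goes by induction on a lower set S of real vertices, one
closed under predecessors, with the edges [below] it, which start in S or
nowhere.  Let e be the last edge that ends in S, and v its target.  The edges
that leave v come after e, so none of them ends in S ([exists_top]).  Cut just
before v: S minus v is again lower, and the edges [above] the cut, those below S
that do not end in S minus v, together with v alone form a piece consisting of
a corolla and free strands.  The cut consists of the edges in both pieces, that
is of the outgoing legs of the lower piece, which are also the incoming legs of
the upper one.

Grafting recovers the piece S because both factors are described by the same
edges ([comp_realizes]).  The delicate point is the order.  Between two
consecutive cut edges the composite lists first the edges of the upper factor
and then those of the lower one, so it agrees with the given order exactly when
every lower edge a that precedes an upper edge b is separated from b by a cut
edge.  Here b leaves v, and any edge i entering v belongs to the cut and has a
path to b.  If a precedes i, then i separates.  Otherwise a lies between i and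
b, so by planarity either i reaches a or a reaches b.  The former would lead
through v back into S, which is impossible; in the latter case the path from a
to b enters v along a cut edge, which separates
([below_above_between]). *)

Set Implicit Arguments.
Unset Strict Implicit.
Unset Printing Implicit Defensive.

(** * Skeletons and their realizations *)

(** [send e true] is the real vertex that [e] enters and [send e false] the one
it leaves, so that the end of sign s of an edge sits in [send e s]. *)
Record skeleton := Skeleton {
  sedge : finType;
  svert : finType;
  send : sedge -> bool -> option svert;
  before : rel sedge }.

Section Skeleton.
Variable K : skeleton.
Implicit Types (e : sedge K) (v : svert K) (s : bool).
Implicit Types (S : {set svert K}) (A : {set sedge K}).

(** An edge without a real target must not be followed by the edges without a
real source, although both ends are [None]. *)
Definition step : rel (sedge K) := fun e e' =>
  (send e true == send e' false) && (send e true != None).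

(** An edge may not return to the real vertex it leaves: a vertex containing a
two-element orbit of the involution is virtual. *)
Record planar_skeleton : Prop := PlanarSkeleton {
  before_irr : irreflexive (@before K);
  before_trans : transitive (@before K);
  before_total : forall e e', e != e' -> before e e' || before e' e;
  send_onto : forall v s, exists e, send e s = Some v;
  send_noloop : forall e v, send e true = Some v -> send e false <> Some v;
  connect_before : forall e e', e != e' -> connect step e e' -> before e e';
  connect_convex : forall e1 e2 e3, connect step e1 e2 ->
    before e1 e3 -> before e3 e2 -> connect step e1 e3 || connect step e3 e2 }.

Definition attached S e s : bool := if send e s is Some v then v \in S else false.

(** An edge with one attached end is a real leg and has only that half-edge;
with two attached ends, or with none, it has both half-edges. *)
Definition present S A e s : bool :=
  (e \in A) && (attached S e s || ~~ attached S e (~~ s)).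

(** The edges that become virtual in the piece. *)
Definition isolated S A : {set sedge K} :=
  [set e in A | ~~ attached S e true && ~~ attached S e false].

Definition star (X : pgraph) (lab : half X -> sedge K) v : {set half X} :=
  [set h | send (lab h) (sgn h) == Some v].

Definition fiber (X : pgraph) (lab : half X -> sedge K) e : {set half X} :=
  [set h | lab h == e].

(** The conditions that determine half-edges, signs and involution.  They are
kept apart from the conditions on vertices and order since the latter are stated
for edges, which the labelling already identifies ([edge_fiber]). *)
Record labelling S A (X : pgraph) (lab : half X -> sedge K) : Prop := Labelling {
  lab_inj : forall h h', lab h = lab h' -> sgn h = sgn h' -> h = h';
  lab_present : forall h, present S A (lab h) (sgn h);
  lab_onto : forall e s, present S A e s -> exists h, lab h = e /\ sgn h = s;
  lab_inv : forall h, lab (inv h) = lab h;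
  sgn_inv : forall h, sgn (inv h) = sgn h (+) present S A (lab h) (~~ sgn h) }.

Record realizes S A (X : pgraph) (lab : half X -> sedge K) : Prop := Realizes {
  realizes_labelling :> labelling S A lab;
  lab_vertices :
    vertices X = [set star lab v | v in S] :|: [set fiber lab e | e in isolated S A];
  lab_prec : forall h h', prec (edge h) (edge h') = before (lab h) (lab h') }.

Lemma before_asym e e' : planar_skeleton -> before e e' -> before e' e = false.
Proof.
move=> HK b; apply/negP => /(before_trans HK b).
by rewrite (before_irr HK).
Qed.

Lemma attachedP S e s : reflect (exists2 v, v \in S & send e s = Some v) (attached S e s).
Proof.
rewrite /attached; case: (send e s) => [v|]; apply: (iffP idP) => //.
- by exists v.
- by case=> w wS [->].
- by case.
Qed.

Lemma attachedU S1 S2 e s :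
  attached (S1 :|: S2) e s = attached S1 e s || attached S2 e s.
Proof. by rewrite /attached; case: (send e s) => [v|]; rewrite ?inE. Qed.

Lemma isolatedE S A e s :
  (e \in isolated S A) = (e \in A) && (~~ attached S e s && ~~ attached S e (~~ s)).
Proof. by rewrite inE; case: s => //=; rewrite [X in _ && X]andbC. Qed.

Lemma edge_fiber S A (X : pgraph) (lab : half X -> sedge K) (h : half X) :
  labelling S A lab -> edge h = fiber lab (lab h).
Proof.
move=> HX.
apply/setP=> h'; rewrite !inE; apply/orP/eqP => [[] /eqP-> // | E].
  exact: (lab_inv HX).
have [Es|Es] := eqVneq (sgn h') (sgn h); first by left; rewrite (lab_inj HX E Es).
right; apply/eqP/(lab_inj HX); first by rewrite (lab_inv HX).
have Es' : sgn h' = ~~ sgn h by case: (sgn h') (sgn h) Es => [] [].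
by rewrite (sgn_inv HX) -E -Es' (lab_present HX) addbT.
Qed.

Section Realization.
Hypothesis HK : planar_skeleton.
Variables (S : {set svert K}) (A : {set sedge K}).
Hypothesis SA : forall e s, attached S e s -> e \in A.
Variables (X : pgraph) (lab : half X -> sedge K).
Hypothesis HX : realizes S A lab.
Implicit Types h : half X.

Lemma lab_mem h : lab h \in A.
Proof. by case/andP: (lab_present HX h). Qed.

Lemma mem_edge h h' : (h' \in edge h) = (lab h' == lab h).
Proof. by rewrite (edge_fiber _ HX) inE. Qed.

Lemma edge_eq h h' : (edge h == edge h') = (lab h == lab h').
Proof.
apply/eqP/eqP => [E|E]; last by rewrite !(edge_fiber _ HX) E.
by apply/eqP; rewrite -mem_edge -E mem_edge.
Qed.

Lemma inv_fixed h : (inv h == h) = ~~ present S A (lab h) (~~ sgn h).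
Proof.
apply/eqP/idP => [E|np].
  move/(congr1 (@sgn X)): E; rewrite (sgn_inv HX).
  by case: present => //; case: (sgn h).
apply/(lab_inj HX); first exact: (lab_inv HX).
by rewrite (sgn_inv HX) (negbTE np) addbF.
Qed.

Lemma inv_inv h : inv (inv h) = h.
Proof.
apply: (lab_inj HX); first by rewrite !(lab_inv HX).
rewrite !(sgn_inv HX) (lab_inv HX).
case p: (present S A (lab h) (~~ sgn h)); last by rewrite addbF p addbF.
by rewrite addbT negbK (lab_present HX) addbT negbK.
Qed.

Lemma fixedE h :
  (inv h == h) = attached S (lab h) (sgn h) && ~~ attached S (lab h) (~~ sgn h).
Proof.
rewrite inv_fixed /present lab_mem /= negbK.
have := lab_present HX h; rewrite /present lab_mem /=.
by case: attached; case: attached.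
Qed.

(** The edge of a non-fixed half-edge cannot be the [star] of a vertex v, as it
would join v to itself. *)
Lemma fiber_isolated h : inv h != h ->
  (edge h \in vertices X) = (lab h \in isolated S A).
Proof.
move=> nf; rewrite (lab_vertices HX) inE.
apply/orP/idP => [[] | i]; last by right; apply/imsetP; exists (lab h); rewrite ?(edge_fiber _ HX).
  case/imsetP => v vS E; exfalso.
  have m h' : h' \in edge h -> send (lab h') (sgn h') = Some v.
    by rewrite E inE => /eqP.
  have m1 := m h (set21 _ _); have := m _ (set22 _ _).
  have p : present S A (lab h) (~~ sgn h) by move: nf; rewrite inv_fixed negbK.
  rewrite (lab_inv HX) (sgn_inv HX) p addbT => m2.
  by case: (sgn h) m1 m2 => /= m1 m2; [apply: (send_noloop HK m1)|apply: (send_noloop HK m2)].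
case/imsetP => e ie E.
have : h \in edge h by exact: set21.
by rewrite E inE => /eqP->.
Qed.

Lemma virtual_legE h :
  virtual_leg h = ~~ attached S (lab h) (sgn h) && ~~ attached S (lab h) (~~ sgn h).
Proof.
rewrite /virtual_leg; have [f|nf] := boolP (inv h == h).
  by move: f; rewrite fixedE => /andP[->].
by rewrite fiber_isolated // (isolatedE _ _ _ (sgn h)) lab_mem.
Qed.

(** Both kinds of legs obey one rule: the opposite end of the edge is free. *)
Lemma legE h : leg h = ~~ attached S (lab h) (~~ sgn h).
Proof. by rewrite /leg /real_leg fixedE virtual_legE; case: attached; rewrite ?orbF. Qed.

Lemma star_onto v s : v \in S -> exists2 h, h \in star lab v & sgn h = s.
Proof.
move=> vS; have [e E] := send_onto HK v s.
have a : attached S e s by apply/attachedP; exists v.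
have [|h [E1 E2]] := lab_onto HX (e := e) (s := s); first by rewrite /present (SA a) a.
by exists h => //; rewrite inE E1 E2 E.
Qed.

Lemma fiber_onto e s : e \in isolated S A -> exists2 h, h \in fiber lab e & sgn h = s.
Proof.
rewrite (isolatedE _ _ _ s) => /and3P[eA _ n].
have [|h [E1 E2]] := lab_onto HX (e := e) (s := s); first by rewrite /present eA n orbT.
by exists h => //; rewrite inE E1.
Qed.

Lemma star_virtual v : v \in S -> ~~ virtual_vertex (star lab v).
Proof.
move=> vS; apply/negP => /andP[sX /existsP[h /andP[nf /eqP E]]].
have := fiber_isolated nf; rewrite -E sX => /esym.
have : h \in star lab v by rewrite E set21.
rewrite inE (isolatedE _ _ _ (sgn h)) => /eqP a /and3P[_ /negP[]].
by apply/attachedP; exists v.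
Qed.

Lemma fiber_virtual e : e \in isolated S A -> virtual_vertex (fiber lab e).
Proof.
move=> ie; apply/andP; split.
  by rewrite (lab_vertices HX) inE; apply/orP; right; apply: imset_f.
have [h he sh] := fiber_onto true ie.
apply/existsP; exists h; move: he; rewrite inE => /eqP he.
rewrite (edge_fiber _ HX) he eqxx andbT fixedE he.
by move: ie; rewrite (isolatedE _ _ _ (sgn h)) => /and3P[_ /negbTE->].
Qed.

Lemma real_verticesE : real_vertices X = [set star lab v | v in S].
Proof.
apply/setP=> w; rewrite inE (lab_vertices HX) inE.
apply/andP/imsetP => [[/orP[/imsetP[v vS ->] _|/imsetP[e ie ->]]]|[v vS ->]].
- by exists v.
- by rewrite fiber_virtual.
- by rewrite star_virtual // imset_f.
Qed.

Lemma star_inj : {in S &, injective (star lab)}.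
Proof.
move=> v v' vS v'S E; have [h hv _] := star_onto true vS.
by move: (hv); rewrite E; move: hv; rewrite !inE => /eqP-> /eqP[].
Qed.

Lemma card_real_vertices : #|real_vertices X| = #|S|.
Proof. by rewrite real_verticesE card_in_imset //; exact: star_inj. Qed.

Lemma realizes_graph : is_graph X.
Proof.
split; last 1 first.
- move=> w h wX hw ihw nf.
  move: wX; rewrite (lab_vertices HX) inE => /orP[] /imsetP[].
    move=> v vS E; move: hw ihw; rewrite E !inE => /eqP m1 /eqP.
    have p : present S A (lab h) (~~ sgn h) by move: nf; rewrite inv_fixed negbK.
    rewrite (lab_inv HX) (sgn_inv HX) p addbT => m2; exfalso.
    by case: (sgn h) m1 m2 => /= m1 m2; [apply: (send_noloop HK m1)|apply: (send_noloop HK m2)].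
  by move=> e ie E; rewrite (edge_fiber _ HX) E; move: hw; rewrite E inE => /eqP->.
- apply/and3P; split.
  + apply/eqP/setP=> h; rewrite inE; apply/bigcupP.
    have [a|na] := boolP (attached S (lab h) (sgn h)).
      case/attachedP: a => v vS E; exists (star lab v); last by rewrite inE E.
      by rewrite (lab_vertices HX) inE imset_f.
    exists (fiber lab (lab h)); last by rewrite inE.
    rewrite (lab_vertices HX) inE; apply/orP; right; apply: imset_f.
    rewrite (isolatedE _ _ _ (sgn h)) lab_mem na /=.
    by case/andP: (lab_present HX h) => _; rewrite (negbTE na).
  + have dis w w' h : w \in vertices X -> w' \in vertices X -> h \in w -> h \in w' -> w = w'.
      rewrite (lab_vertices HX) !inE => /orP[]/imsetP[x xS ->] /orP[]/imsetP[y yS ->]; rewrite !inE.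
      * by move=> /eqP-> /eqP[->].
      * move=> /eqP a /eqP b; move: yS; rewrite (isolatedE _ _ _ (sgn h)) -b => /and3P[_ /negP[]].
        by apply/attachedP; exists x.
      * move=> /eqP b /eqP a; move: xS; rewrite (isolatedE _ _ _ (sgn h)) -b => /and3P[_ /negP[]].
        by apply/attachedP; exists y.
      * by move=> /eqP-> /eqP->.
    apply/trivIsetP => w w' wX w'X; apply: contraR => /pred0Pn[h /andP[hw hw']].
    by apply/eqP/(dis _ _ h).
  + apply/negP; rewrite (lab_vertices HX) inE => /orP[] /imsetP[x xS] /setP E.
      by have [h + _] := star_onto true xS; rewrite -E inE.
    by have [h + _] := fiber_onto true xS; rewrite -E inE.
- exact: inv_inv.
Qed.

Lemma realizes_directed : is_directed X.
Proof.
split=> [h|w].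
  by rewrite inv_fixed negbK (sgn_inv HX) => ->; rewrite addbT.
rewrite (lab_vertices HX) inE => /orP[] /imsetP[x xS ->]; split; apply/set0Pn.
- by have [h m sh] := star_onto true xS; exists h; rewrite inE m sh.
- by have [h m sh] := star_onto false xS; exists h; rewrite inE m sh.
- by have [h m sh] := fiber_onto true xS; exists h; rewrite inE m sh.
- by have [h m sh] := fiber_onto false xS; exists h; rewrite inE m sh.
Qed.

Lemma realizes_linear : linear_on_edges X.
Proof.
split.
- by move=> _ /imsetP[h _ ->]; rewrite (lab_prec HX) (before_irr HK).
- move=> _ _ _ /imsetP[h _ ->] /imsetP[h' _ ->] /imsetP[h2 _ ->].
  by rewrite !(lab_prec HX); exact: (before_trans HK).
- move=> _ _ /imsetP[h _ ->] /imsetP[h' _ ->].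
  by rewrite edge_eq !(lab_prec HX); exact: (before_total HK).
Qed.

Lemma follows_lab h h' : follows (edge h) (edge h') ->
  lab h = lab h' \/
  exists2 v, v \in S & send (lab h) true = Some v /\ send (lab h') false = Some v.
Proof.
case/and3P => _ _ /existsP[w /andP[/andP[wX /existsP[x /and3P[xh sx xw]]]]].
case/andP=> _ /existsP[y /and3P[yh sy yw]].
move: xh yh; rewrite !mem_edge => /eqP xh /eqP yh'.
move: wX xw yw; rewrite (lab_vertices HX) inE -xh -yh' => /orP[] /imsetP[v vS ->]; rewrite !inE.
  by rewrite sx (negbTE sy) => /eqP-> /eqP->; right; exists v.
by move=> /eqP-> /eqP->; left.
Qed.

Lemma lab_follows h h' v : v \in S -> send (lab h) true = Some v ->
  send (lab h') false = Some v -> follows (edge h) (edge h').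
Proof.
move=> vS a b; rewrite /follows !imset_f //=; apply/existsP; exists (star lab v).
have sX : star lab v \in vertices X by rewrite (lab_vertices HX) inE imset_f.
have at1 : attached S (lab h) true by apply/attachedP; exists v.
have at2 : attached S (lab h') false by apply/attachedP; exists v.
rewrite /is_target /is_source sX /=; apply/andP; split; apply/existsP.
  have [|x [xh sx]] := lab_onto HX (e := lab h) (s := true).
    by rewrite /present lab_mem at1.
  by exists x; rewrite mem_edge inE xh sx a !eqxx.
have [|x [xh sx]] := lab_onto HX (e := lab h') (s := false).
  by rewrite /present lab_mem at2.
by exists x; rewrite mem_edge inE xh sx b !eqxx.
Qed.

End Realization.

(** In a piece with a single real vertex v, a path has at most one proper step,
from an edge entering v to an edge leaving v, because a third edge would make v
a source and a target of the same edge.  Hence convexity only has to be assumed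
for edges between an incoming and an outgoing one. *)
Lemma corolla_planar v A (X : pgraph) (lab : half X -> sedge K) :
  planar_skeleton ->
  (forall e s, send e s = Some v -> e \in A) ->
  (forall e1 e2 e3, send e1 true = Some v -> send e2 false = Some v -> e3 \in A ->
     before e1 e3 -> before e3 e2 -> send e3 true = Some v \/ send e3 false = Some v) ->
  realizes [set v] A lab -> is_planar X.
Proof.
move=> HK vA conv HX.
have SA e s : attached [set v] e s -> e \in A.
  by case/attachedP => w; rewrite inE => /eqP-> /vA.
have reachE (h : half X) (w : {set half X}) : reaches (edge h) w ->
    exists2 h', w = edge h' &
      lab h = lab h' \/ send (lab h) true = Some v /\ send (lab h') false = Some v.
  case/connectP => p; elim/last_ind: p w => [|p e' IH] w /=.
    by move=> _ ->; exists h => //; left.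
  rewrite rcons_path last_rcons => /andP[pp ff] ->.
  have [h1 E1 D1] := IH _ pp erefl.
  have /imsetP[h' _ E'] : e' \in edges X by case/and3P: ff.
  exists h' => //; move: ff; rewrite E1 E' => /(follows_lab HX)[<- //|].
  case=> u; rewrite inE => /eqP-> [a b]; right.
  by case: D1 => [->|[_ /(send_noloop HK a)]].
split.
- exact: realizes_graph HX.
- exact: realizes_directed HX.
- exact: realizes_linear HX.
- move=> _ _ /imsetP[h _ ->] /imsetP[h' _ ->].
  rewrite (edge_eq HX) (lab_prec HX) => ne /reachE[h2 /eqP].
  rewrite (edge_eq HX) => /eqP <- [E|[a b]].
    by rewrite E eqxx in ne.
  apply: (connect_before HK) => //; apply: connect1.
  by rewrite /step a b eqxx.
- move=> _ _ _ /imsetP[h1 _ ->] /imsetP[h2 _ ->] /imsetP[h3 _ ->].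
  rewrite !(lab_prec HX) => /reachE[h /eqP]; rewrite (edge_eq HX) => /eqP <- [->|[a b]] b1 b2.
    by rewrite (before_asym HK b1) in b2.
  have [c|c] := conv _ _ _ a b (lab_mem HX h3) b1 b2; apply/orP; [right|left]; apply: connect1;
    by apply: (lab_follows HX (v := v)); rewrite ?inE.
Qed.

End Skeleton.

(** * Every piece of a skeleton is realized, uniquely *)

Section Model.
Variables (K : skeleton) (S : {set svert K}) (A : {set sedge K}).

Definition model_half : finType := {p : sedge K * bool | present S A p.1 p.2}.

(** The default value of [insubd] is what keeps a real leg fixed. *)
Definition model_inv (x : model_half) : model_half :=
  insubd x ((val x).1, ~~ (val x).2).

Definition model_vertices : {set {set model_half}} :=
  [set [set x : model_half | send (val x).1 (val x).2 == Some v] | v in S] :|: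
  [set [set x : model_half | (val x).1 == e] | e in isolated S A].

Definition model_graph : graph := Graph model_vertices model_inv.

Definition model : pgraph :=
  @PGraph model_graph (fun x : model_half => (val x).2)
    (fun w w' : {set model_half} =>
       [exists x in w, exists y in w', before (val x).1 (val y).1]).

Lemma model_realizes : realizes S A (fun x : half model => (val x).1).
Proof.
have labI (x : half model) : (val (inv x)).1 = (val x).1.
  by rewrite val_insubd /=; case: ifP.
have labE (x y : half model) : y \in edge x -> (val y).1 = (val x).1.
  by rewrite !inE => /orP[] /eqP->.
split; [split|by []|].
- move=> x y E1 E2; apply/val_inj; move: E1 E2.
  by rewrite /=; case: (val x) (val y) => [? ?] [? ?] /= -> ->.
- by move=> x; exact: (valP x).
- by move=> e s p; exists (Sub (e, s) p); rewrite SubK.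
- exact: labI.
- move=> x; rewrite /= val_insubd /=.
  by case: present => /=; rewrite ?addbT ?addbF.
- move=> x y; apply/existsP/idP => [[x' /andP[/labE <- /existsP[y' /andP[/labE <-]]]] //|b].
  exists x; rewrite set21 /=; apply/existsP; exists y; by rewrite set21.
Qed.
End Model.

(** A half-edge is determined by its label and sign, so matching these gives the
isomorphism; every other structure is expressed through labels and signs. *)
Lemma realizations_iso (K : skeleton) S A (X Y : pgraph) labX labY :
  @realizes K S A X labX -> @realizes K S A Y labY -> planar_iso X Y.
Proof.
move=> HX HY.
(* The matching of half-edges, to be used in both directions. *)
have transport (U W : pgraph) labU labW :
    @realizes K S A U labU -> @realizes K S A W labW ->
    exists f : half U -> half W, forall h, labW (f h) = labU h /\ sgn (f h) = sgn h.
  move=> HU HW; apply: (@fin_all_exists _ _ (fun h u => labW u = labU h /\ sgn u = sgn h)).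
  by move=> h; apply: (lab_onto HW); exact: (lab_present HU).
have [f fP] := transport _ _ _ _ HX HY; have [g gP] := transport _ _ _ _ HY HX.
have fg : cancel f g.
  move=> h; have [l1 s1] := gP (f h); have [l2 s2] := fP h.
  by apply: (lab_inj HX); rewrite ?l1 ?s1.
have gf : cancel g f.
  move=> h; have [l1 s1] := fP (g h); have [l2 s2] := gP h.
  by apply: (lab_inj HY); rewrite ?l1 ?s1.
have fl h : labY (f h) = labX h by case: (fP h).
have fs h : sgn (f h) = sgn h by case: (fP h).
have f_inv h : f (inv h) = inv (f h).
  apply: (lab_inj HY); first by rewrite fl (lab_inv HX) (lab_inv HY) fl.
  by rewrite fs (sgn_inv HX) (sgn_inv HY) fl fs.
have f_pre (P : sedge K -> bool -> bool) :
    f @: [set h | P (labX h) (sgn h)] = [set h | P (labY h) (sgn h)].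
  apply/setP=> h; rewrite -[h]gf mem_imset; last exact: can_inj fg.
  by rewrite !inE fl fs.
have f_star v : f @: star labX v = star labY v by exact: (f_pre (fun e s => send e s == Some v)).
have f_fib e : f @: fiber labX e = fiber labY e by exact: (f_pre (fun e' _ => e' == e)).
have f_vert : vertices Y = [set f @: w | w : {set half X} in vertices X].
  rewrite (lab_vertices HX) (lab_vertices HY) imsetU -!imset_comp.
  by congr (_ :|: _); apply: eq_imset => x /=.
have f_edge h : f @: edge h = edge (f h).
  by rewrite (edge_fiber _ HX) (edge_fiber _ HY) f_fib fl.
exists f; split => //.
- split => //; first by exists g.
  by move=> w; rewrite f_vert mem_imset //; exact: imset_inj (can_inj fg).
- move=> _ _ /imsetP[h _ ->] /imsetP[h' _ ->].
  by rewrite !f_edge (lab_prec HX) (lab_prec HY) !fl.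
Qed.

(** * Composition glues two pieces along a cut *)

(* After a case split on booleans, closes a branch in which some hypothesis *)
(* with a true premise has a false conclusion.                              *)
Ltac contradict_case :=
  solve [ done | match goal with
    | H : is_true true -> _ |- _ => by [move: (H isT) | case: (H isT erefl)] end ].

(** [cut1] and [cut2] say that the edges common to both pieces are exactly those
without target in S1, and exactly those without source in S2.  The hypothesis
[cut_between] makes the order of the composite agree with the given one. *)
Section Gluing.
Variable K : skeleton.
Hypothesis HK : planar_skeleton K.
Variables (S1 S2 : {set svert K}) (A1 A2 : {set sedge K}).
Hypothesis SA1 : forall e s, attached S1 e s -> e \in A1.
Hypothesis SA2 : forall e s, attached S2 e s -> e \in A2.
Hypothesis cut1 : forall e, e \in A1 -> (e \in A2) = ~~ attached S1 e true.
Hypothesis cut2 : forall e, e \in A2 -> (e \in A1) = ~~ attached S2 e false.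
Hypothesis cut_between : forall a b, a \in A1 -> a \notin A2 -> b \in A2 -> b \notin A1 ->
  before a b -> exists2 c, c \in A1 :&: A2 & before a c && before c b.
Variables (X Y : pgraph) (labX : half X -> sedge K) (labY : half Y -> sedge K).
Hypothesis HX : realizes S1 A1 labX.
Hypothesis HY : realizes S2 A2 labY.
Implicit Types (e : sedge K) (s : bool) (h : half X) (g : half Y).

Lemma glue_gOut h : (h \in gOut X) = (labX h \in A2) && ~~ sgn h.
Proof.
rewrite inE (legE HK HX) (cut1 (lab_mem HX h)).
by case: (sgn h); rewrite ?andbF.
Qed.

Lemma glue_gIn g : (g \in gIn Y) = (labY g \in A1) && sgn g.
Proof.
rewrite inE (legE HK HY) (cut2 (lab_mem HY g)).
by case: (sgn g); rewrite ?andbF.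
Qed.

(** The number of cut edges before an edge is at once its rank among the
outgoing legs of X and among the incoming legs of Y, so that grafting legs of
equal rank identifies half-edges with the same label ([graftedE]). *)
Definition cut_rank e := #|[set c in A1 :&: A2 | before c e]|.

Lemma gOut_onto e : e \in A1 :&: A2 -> exists2 h, h \in gOut X & labX h = e.
Proof.
rewrite inE => /andP[e1 e2]; have := cut1 e1; rewrite e2 => /esym n.
have [|h [he sh]] := lab_onto HX (e := e) (s := false); first by rewrite /present e1 n orbT.
by exists h; rewrite // glue_gOut he e2 sh.
Qed.

Lemma gIn_onto e : e \in A1 :&: A2 -> exists2 g, g \in gIn Y & labY g = e.
Proof.
rewrite inE => /andP[e1 e2]; have := cut2 e2; rewrite e1 => /esym n.
have [|g [ge sg]] := lab_onto HY (e := e) (s := true); first by rewrite /present e2 n orbT.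
by exists g; rewrite // glue_gIn ge e1 sg.
Qed.

Lemma gOut_inj : {in gOut X &, injective labX}.
Proof.
move=> h h'; rewrite !glue_gOut => /andP[_ /negbTE s1] /andP[_ /negbTE s2] E.
by apply: (lab_inj HX E); rewrite s1.
Qed.

Lemma gIn_inj : {in gIn Y &, injective labY}.
Proof.
move=> h h'; rewrite !glue_gIn => /andP[_ s1] /andP[_ s2] E.
by apply: (lab_inj HY E); rewrite s1.
Qed.

Lemma glue_out_rank h : out_rank (edge h) = cut_rank (labX h).
Proof.
rewrite /out_rank -(card_in_imset (f := labX)).
  apply: eq_card => c; apply/imsetP/setIdP => [[o /setIdP[o1 o2] ->]|[c12 cb]].
    move: o2; rewrite (lab_prec HX) => ->; split=> //.
    by move: o1; rewrite glue_gOut inE (lab_mem HX) => /andP[->].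
  have [o o1 oc] := gOut_onto c12; exists o => //.
  by apply/setIdP; split; rewrite ?(lab_prec HX) ?oc.
by move=> o o' /setIdP[o1 _] /setIdP[o2 _]; exact: gOut_inj.
Qed.

Lemma glue_in_rank g : in_rank (edge g) = cut_rank (labY g).
Proof.
rewrite /in_rank -(card_in_imset (f := labY)).
  apply: eq_card => c; apply/imsetP/setIdP => [[o /setIdP[o1 o2] ->]|[c12 cb]].
    move: o2; rewrite (lab_prec HY) => ->; split=> //.
    by move: o1; rewrite glue_gIn inE (lab_mem HY) => /andP[->].
  have [o o1 oc] := gIn_onto c12; exists o => //.
  by apply/setIdP; split; rewrite ?(lab_prec HY) ?oc.
by move=> o o' /setIdP[o1 _] /setIdP[o2 _]; exact: gIn_inj.
Qed.

Lemma glue_composable : composable X Y.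
Proof.
rewrite /composable -(card_in_imset gOut_inj) -(card_in_imset gIn_inj).
apply: eq_card => c; apply/imsetP/imsetP => [[o oX ->]|[i iY ->]].
  have [|i iY E] := @gIn_onto (labX o); last by exists i.
  by move: oX; rewrite glue_gOut inE (lab_mem HX) => /andP[->].
have [|o oX E] := @gOut_onto (labY i); last by exists o.
by move: iY; rewrite glue_gIn inE (lab_mem HY) => /andP[->].
Qed.

Lemma cut_rank_le e e' : before e e' -> cut_rank e <= cut_rank e'.
Proof.
move=> b; apply: subset_leq_card; apply/subsetP=> c; rewrite !inE => /andP[-> c_b].
exact: (before_trans HK c_b b).
Qed.

Lemma cut_rank_lt e e' : e \in A1 -> e \in A2 -> before e e' -> cut_rank e < cut_rank e'.
Proof.
move=> e1 e2 b; apply: proper_card; apply/properP; split.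
  apply/subsetP=> c; rewrite !inE => /andP[-> c_b]; exact: (before_trans HK c_b b).
by exists e; rewrite !inE e1 e2 ?b ?(before_irr HK).
Qed.

Lemma cut_rank_inj e e' : e \in A1 -> e \in A2 -> e' \in A1 -> e' \in A2 ->
  cut_rank e = cut_rank e' -> e = e'.
Proof.
move=> e1 e2 e1' e2' E; apply/eqP/negPn/negP => /(before_total HK) /orP[] /cut_rank_lt.
  by rewrite E ltnn => /(_ e1 e2).
by rewrite E ltnn => /(_ e1' e2').
Qed.

Lemma graftedE h g : grafted h g = [&& ~~ sgn h, sgn g & labX h == labY g].
Proof.
rewrite /grafted glue_gOut glue_gIn glue_out_rank glue_in_rank.
have m1 := lab_mem HX h; have m2 := lab_mem HY g.
apply/and3P/and3P => [[/andP[h1 ->] /andP[g1 ->] /eqP E]|[-> -> /eqP E]].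
  by split=> //; apply/eqP; apply: cut_rank_inj.
by rewrite E m2 -E m1; split.
Qed.

Lemma cutX e : e \in A1 -> e \in A2 -> attached S1 e true = false.
Proof. by move=> /cut1 -> /negbTE. Qed.

Lemma cutY e : e \in A1 -> e \in A2 -> attached S2 e false = false.
Proof. by move=> e1 /cut2; rewrite e1 => /esym /negbTE. Qed.

Lemma glue_virtual_legX h : labX h \in A2 ->
  virtual_leg h = ~~ attached S1 (labX h) false.
Proof.
move=> h2; have := cutX (lab_mem HX h) h2.
by rewrite (virtual_legE HK HX) => a; case: (sgn h); rewrite /= a ?andbT.
Qed.

Lemma glue_virtual_legY g : labY g \in A1 ->
  virtual_leg g = ~~ attached S2 (labY g) true.
Proof.
move=> h2; have := cutY h2 (lab_mem HY g).
by rewrite (virtual_legE HK HY) => a; case: (sgn g); rewrite /= a ?andbT.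
Qed.

Lemma glue_real_legX h : labX h \in A2 ->
  real_leg h = attached S1 (labX h) false && ~~ sgn h.
Proof.
move=> h2; have a := cutX (lab_mem HX h) h2.
rewrite /real_leg (fixedE HX); case: (sgn h) => /=; rewrite a ?andbF ?andbT //.
Qed.

Lemma glue_real_legY g : labY g \in A1 ->
  real_leg g = attached S2 (labY g) true && sgn g.
Proof.
move=> h2; have a := cutY h2 (lab_mem HY g).
rewrite /real_leg (fixedE HY); case: (sgn g) => /=; rewrite a ?andbF ?andbT //.
Qed.

(** On a cut edge, [attached S1 e false] and [attached S2 e true] tell whether
the legs of X and Y are real.  A virtual leg of X is lost, and so is its
opposite half-edge if the leg of Y is real.  [lostY] is the mirror image. *)
Definition lostX e s :=
  [&& e \in A2, ~~ attached S1 e false & ~~ s || attached S2 e true].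
Definition lostY e s :=
  [&& e \in A1, ~~ attached S2 e true & s || attached S1 e false].

Lemma deletedX h : @deleted X Y (inl h) = lostX (labX h) (sgn h).
Proof.
have h1 := lab_mem HX h.
apply/existsP/and3P => [[o /existsP[i]]|[h2 n d]].
  rewrite graftedE => /and3P[/and3P[so si /eqP E] vo].
  have o2 : labX o \in A2 by rewrite E (lab_mem HY).
  have i1 : labY i \in A1 by rewrite -E (lab_mem HX).
  move: vo; rewrite (glue_virtual_legX o2) (glue_real_legY i1) si andbT -E => no.
  case/orP => [/eqP-> |/andP[/eqP-> b]]; rewrite ?(lab_inv HX).
    by rewrite so.
  by rewrite b orbT.
have c : labX h \in A1 :&: A2 by rewrite inE h1.
have [o] := gOut_onto c; have [i] := gIn_onto c.
rewrite glue_gIn glue_gOut => /andP[i1 si] Ei /andP[o2 so] Eo.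
exists o; apply/existsP; exists i.
rewrite graftedE so si Ei Eo eqxx (glue_virtual_legX o2) Eo n (glue_real_legY i1) Ei si andbT /=.
have [sh|sh] := boolP (sgn h); last first.
  by rewrite (lab_inj HX (h := h) (h' := o)) ?eqxx ?Eo // (negbTE so) (negbTE sh).
rewrite sh /= in d; rewrite d !andbT; apply/orP; right; apply/eqP; apply: (lab_inj HX).
  by rewrite (lab_inv HX) Eo.
rewrite (sgn_inv HX) (negbTE so) Eo; have := lab_present HX h.
by rewrite sh => ->.
Qed.

Lemma deletedY g : @deleted X Y (inr g) = lostY (labY g) (sgn g).
Proof.
have h2 := lab_mem HY g.
apply/existsP/and3P => [[o /existsP[i]]|[h1 n d]].
  rewrite graftedE => /and3P[/and3P[so si /eqP E] vi].
  have o2 : labX o \in A2 by rewrite E (lab_mem HY).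
  have i1 : labY i \in A1 by rewrite -E (lab_mem HX).
  move: vi; rewrite (glue_virtual_legY i1) (glue_real_legX o2) so andbT E => no.
  case/orP => [/eqP-> |/andP[/eqP-> b]]; rewrite ?(lab_inv HY).
    by rewrite si.
  by rewrite b orbT.
have c : labY g \in A1 :&: A2 by rewrite inE h1.
have [o] := gOut_onto c; have [i] := gIn_onto c.
rewrite glue_gIn glue_gOut => /andP[i1 si] Ei /andP[o2 so] Eo.
exists o; apply/existsP; exists i.
rewrite graftedE so si Ei Eo eqxx (glue_virtual_legY i1) Ei n (glue_real_legX o2) Eo so andbT /=.
have [sg|sg] := boolP (sgn g).
  by rewrite (lab_inj HY (h := g) (h' := i)) ?eqxx ?Ei // si sg.
rewrite (negbTE sg) /= in d; rewrite d !andbT; apply/orP; right; apply/eqP; apply: (lab_inj HY).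
  by rewrite (lab_inv HY) Ei.
rewrite (sgn_inv HY) si Ei; have := lab_present HY g.
by rewrite (negbTE sg) => ->.
Qed.

(** The two grafted legs are joined if both are real.  If both are virtual it is
their opposites that are joined, which reverses the signs. *)
Lemma joinedE h g : joined h g = [&& labX h == labY g,
  attached S1 (labX h) false == attached S2 (labX h) true,
  sgn h == ~~ attached S1 (labX h) false & sgn g == attached S1 (labX h) false].
Proof.
rewrite /joined !graftedE !(lab_inv HX) !(lab_inv HY).
have [E|_] := eqVneq (labX h) (labY g); last by rewrite !andbF.
have h2 : labX h \in A2 by rewrite E (lab_mem HY).
have g1 : labY g \in A1 by rewrite -E (lab_mem HX).
rewrite (glue_real_legX h2) (glue_real_legY g1) (glue_virtual_legX h2) (glue_virtual_legY g1).
rewrite (sgn_inv HX) (sgn_inv HY) -E /present h2 (lab_mem HX h) /= !negbK.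
have := cutX (lab_mem HX h) h2; have := cutY (lab_mem HX h) h2.
have := lab_present HX h; have := lab_present HY g.
rewrite -E /present h2 (lab_mem HX h) /=.
case: (sgn h); case: (sgn g) => /=;
by case: (attached S1 (labX h) true); case: (attached S1 (labX h) false);
   case: (attached S2 (labX h) true); case: (attached S2 (labX h) false).
Qed.

Local Notation S := (S1 :|: S2).
Local Notation A := (A1 :|: A2).

(** For a cut edge, let a and b tell whether it comes from S1 and goes to S2.
The half-edges kept are: for a and b, the outgoing one of X and the incoming one
of Y; for exactly one of them, the one attached; for neither, the incoming one
of X and the outgoing one of Y. *)
Lemma present_glue e s : present S A e s =
  present S1 A1 e s && ~~ lostX e s || present S2 A2 e s && ~~ lostY e s.
Proof.
rewrite /present /lostX /lostY inE !attachedU.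
have := @SA1 e true; have := @SA1 e false; have := @SA2 e true; have := @SA2 e false.
have := @cut1 e; have := @cut2 e.
case: (e \in A1); case: (e \in A2); case: s => /=;
case: (attached S1 e true); case: (attached S1 e false);
case: (attached S2 e true); case: (attached S2 e false) => //= H1 H2 H3 H4 H5 H6;
contradict_case.
Qed.

Lemma present_disjoint e s : present S1 A1 e s -> ~~ lostX e s ->
  present S2 A2 e s -> ~~ lostY e s -> False.
Proof.
rewrite /present /lostX /lostY.
have := @cut1 e; have := @cut2 e.
case: (e \in A1); case: (e \in A2); case: s => //=;
case: (attached S1 e true); case: (attached S1 e false);
case: (attached S2 e true); case: (attached S2 e false) => //= H1 H2;
contradict_case.
Qed.

Definition glue_label (x : half X + half Y) : sedge K :=
  match x with inl h => labX h | inr g => labY g end.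

Definition glue_sign (x : half X + half Y) : bool :=
  match x with inl h => sgn h | inr g => sgn g end.

Lemma glue_present (x : half X + half Y) :
  ~~ deleted x -> present S A (glue_label x) (glue_sign x).
Proof.
case: x => [h|g]; rewrite ?deletedX ?deletedY present_glue /= => ->.
  by rewrite (lab_present HX).
by rewrite (lab_present HY) orbT.
Qed.

Lemma glue_inj (x y : half X + half Y) : ~~ deleted x -> ~~ deleted y ->
  glue_label x = glue_label y -> glue_sign x = glue_sign y -> x = y.
Proof.
case: x => [h|g]; case: y => [h'|g']; rewrite ?deletedX ?deletedY /= => d d' E Es.
- by rewrite (lab_inj HX E Es).
- rewrite -E -Es in d'; case: (present_disjoint (lab_present HX h) d _ d').
  by rewrite E Es (lab_present HY).
- rewrite -E -Es in d'; case: (present_disjoint _ d' (lab_present HY g) d).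
  by rewrite E Es (lab_present HX).
- by rewrite (lab_inj HY E Es).
Qed.

(** [joined_inv] stays among the kept half-edges and does what a labelling
requires of the involution. *)
Lemma glue_joined_inv (x : half X + half Y) : ~~ deleted x ->
  [/\ ~~ deleted (joined_inv x), glue_label (joined_inv x) = glue_label x &
      glue_sign (joined_inv x) = glue_sign x (+) present S A (glue_label x) (~~ glue_sign x)].
Proof.
case: x => [h|g]; rewrite ?deletedX ?deletedY /=.
- have := lab_mem HX h; have := lab_present HX h.
  (* If no partner is found, then the legs on a cut edge are not both real or both *)
  (* virtual, since Y would otherwise contain the partner; inv h then has the *)
  (* required sign, which is checked on all combinations of attached ends. *)
  case: pickP => [g|noj]; rewrite ?deletedX ?deletedY /=.
    rewrite joinedE => /and4P[/eqP E /eqP a /eqP sh /eqP sg] p e1 d; have e2 := lab_mem HY g.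
    rewrite -E in e2 *.
    rewrite /lostY /present inE !attachedU sh sg e1 e2.
    have c1 := cutX e1 e2; have c2 := cutY e1 e2.
    by case E1: (attached S1 (labX h) false) a => <-; rewrite /= ?E1 ?c1 ?c2.
  move=> p e1 d; rewrite (lab_inv HX) (sgn_inv HX) present_glue.
  have noj' g : labX h = labY g -> sgn h = ~~ attached S1 (labX h) false ->
      attached S1 (labX h) false = attached S2 (labX h) true -> sgn g <> attached S1 (labX h) false.
    by move=> E1 E2 E3 E4; have := noj g; rewrite joinedE -E1 -E2 E3 E4 -E3 !eqxx.
  have {}noj' : labX h \in A2 -> sgn h = ~~ attached S1 (labX h) false ->
      attached S1 (labX h) false <> attached S2 (labX h) true.
    move=> e2 E1 E2.
    have [|g [Eg sg]] := lab_onto HY (e := labX h) (s := attached S2 (labX h) true).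
      by rewrite /present e2 /=; case b: (attached S2 _ true); rewrite /= ?b ?(cutY e1 e2).
    by apply: (noj' g) => //; rewrite E2.
  move: p d noj'; rewrite /present /lostX /lostY e1.
  have := @SA1 (labX h) true; have := @SA1 (labX h) false.
  have := @SA2 (labX h) true; have := @SA2 (labX h) false.
  have := cut1 e1; have := @cut2 (labX h); rewrite e1.
  case: (labX h \in A2); case: (sgn h) => /=;
  case: (attached S1 (labX h) true); case: (attached S1 (labX h) false);
  case: (attached S2 (labX h) true); case: (attached S2 (labX h) false) => //=
    H1 H2 H3 H4 H5 H6 p d noj';
  contradict_case.
- have := lab_mem HY g; have := lab_present HY g.
  case: pickP => [h|noj]; rewrite ?deletedX ?deletedY /=.
    rewrite joinedE => /and4P[/eqP E /eqP a /eqP sh /eqP sg] p; have e1 := lab_mem HX h.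
    rewrite -E => e2 d.
    rewrite /lostX /present inE !attachedU sh sg e1 e2.
    have c1 := cutX e1 e2; have c2 := cutY e1 e2.
    by case E1: (attached S1 (labX h) false) a => <-; rewrite /= ?E1 ?c1 ?c2.
  move=> p e2 d; rewrite (lab_inv HY) (sgn_inv HY) present_glue.
  have noj' h : labX h = labY g -> sgn g = attached S1 (labY g) false ->
      attached S1 (labY g) false = attached S2 (labY g) true ->
      sgn h <> ~~ attached S1 (labY g) false.
    by move=> E1 E2 E3 E4; have := noj h; rewrite joinedE E1 -E3 E2 E4 !eqxx.
  have {}noj' : labY g \in A1 -> sgn g = attached S1 (labY g) false ->
      attached S1 (labY g) false <> attached S2 (labY g) true.
    move=> e1 E1 E2.
    have [|h [Eh sh]] := lab_onto HX (e := labY g) (s := ~~ attached S1 (labY g) false).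
      by rewrite /present e1 /=; case b: (attached S1 _ false); rewrite /= ?b ?(cutX e1 e2).
    by apply: (noj' h).
  move: p d noj'; rewrite /present /lostX /lostY e2.
  have := @SA1 (labY g) true; have := @SA1 (labY g) false.
  have := @SA2 (labY g) true; have := @SA2 (labY g) false.
  have := @cut1 (labY g); have := cut2 e2; rewrite e2.
  case: (labY g \in A1); case: (sgn g) => /=;
  case: (attached S1 (labY g) true); case: (attached S1 (labY g) false);
  case: (attached S2 (labY g) true); case: (attached S2 (labY g) false) => //=
    H1 H2 H3 H4 H5 H6 p d noj';
  contradict_case.
Qed.

Definition comp_label (x : half (comp X Y)) : sedge K := glue_label (val x).

Lemma comp_signE (x : half (comp X Y)) : sgn x = glue_sign (val x).
Proof. by []. Qed.

Lemma comp_labelling : labelling S A comp_label.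
Proof.
have inv_val (x : half (comp X Y)) : val (inv x) = joined_inv (val x).
  by rewrite val_insubd; case: (glue_joined_inv (valP x)) => ->.
split.
- by move=> x y E Es; apply: val_inj; exact: (glue_inj (valP x) (valP y)).
- by move=> x; exact: (glue_present (valP x)).
- move=> e s; rewrite present_glue => /orP[]/andP[p nd].
    have [h [hl hs]] := lab_onto HX p.
    have nd' : ~~ @deleted X Y (inl h) by rewrite deletedX hl hs.
    by exists (exist (fun x => ~~ deleted x) _ nd').
  have [h [hl hs]] := lab_onto HY p.
  have nd' : ~~ @deleted X Y (inr h) by rewrite deletedY hl hs.
  by exists (exist (fun x => ~~ deleted x) _ nd').
- by move=> x; rewrite /comp_label inv_val; case: (glue_joined_inv (valP x)).
- by move=> x; rewrite !comp_signE inv_val; case: (glue_joined_inv (valP x)).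
Qed.

(** A half-edge of Y attached to v would lie on a cut edge coming from S1, so
its leg would have been deleted. *)
Lemma comp_starX v : v \in S1 ->
  [set x : comp_half X Y | val x \in inl @: star labX v] = star comp_label v.
Proof.
move=> vS; apply/setP=> x; rewrite !inE comp_signE /comp_label.
case: x => -[h|g] nd /=; first by rewrite mem_imset ?inE //; exact: inl_inj.
apply/imsetP/eqP => [[] //|E]; exfalso; move: nd; rewrite deletedY /lostY.
have a : attached S1 (labY g) (sgn g) by apply/attachedP; exists v.
have e1 := SA1 a; have c1 := cutX e1 (lab_mem HY g); have c2 := cutY e1 (lab_mem HY g).
have := lab_present HY g; rewrite /present e1 (lab_mem HY) /=; move: a.
by case: (sgn g) => /= a; [rewrite c1 in a | rewrite c2 a => /= ->].
Qed.

Lemma comp_starY v : v \in S2 ->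
  [set x : comp_half X Y | val x \in inr @: star labY v] = star comp_label v.
Proof.
move=> vS; apply/setP=> x; rewrite !inE comp_signE /comp_label.
case: x => -[h|g] nd /=; last by rewrite mem_imset ?inE //; exact: inr_inj.
apply/imsetP/eqP => [[] //|E]; exfalso; move: nd; rewrite deletedX /lostX.
have a : attached S2 (labX h) (sgn h) by apply/attachedP; exists v.
have e2 := SA2 a; have c1 := cutX (lab_mem HX h) e2; have c2 := cutY (lab_mem HX h) e2.
have := lab_present HX h; rewrite /present e2 (lab_mem HX) /=; move: a.
by case: (sgn h) => /= a; [rewrite c1 a => /= -> | rewrite c2 in a].
Qed.

Lemma comp_vertices_glue : vertices (comp X Y) =
  [set star comp_label v | v in S] :|: [set fiber comp_label e | e in isolated S A].
Proof.
rewrite /= /comp_vertices (real_verticesE HK HX) (real_verticesE HK HY) imsetU.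
rewrite -!imset_comp; congr (_ :|: _ :|: _).
- by apply: eq_in_imset => v vS; exact: comp_starX.
- by apply: eq_in_imset => v vS; exact: comp_starY.
apply/setP=> w; apply/imsetP/imsetP => [[x xP ->]|[e ei ->]].
  exists (comp_label x); last by rewrite -(edge_fiber _ comp_labelling).
  move: xP; rewrite inE => /existsP[h /existsP[g /and4P[/eqP E j vh vg]]].
  rewrite /comp_label E /=; move: j; rewrite joinedE => /and4P[/eqP El /eqP a _ _].
  have e1 := lab_mem HX h; have e2 := lab_mem HY g; rewrite -El in e2.
  rewrite inE inE e1 !attachedU (cutX e1 e2) (cutY e1 e2) orbF -a /=.
  by rewrite -glue_virtual_legX ?vh.
have := ei; rewrite inE !attachedU !negb_or => /and3P[eA /andP[n1 n2] /andP[n3 n4]].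
have e1 : e \in A1.
  by have := cut2 (e := e); rewrite n4; move: eA; rewrite inE; case: (e \in A1) => //= eA /(_ eA).
have e2 : e \in A2 by rewrite cut1.
have [|x [xl xs]] := lab_onto comp_labelling (e := e) (s := true).
  by rewrite /present eA /= attachedU (negbTE n1) (negbTE n2) attachedU (negbTE n3).
have [|y [yl ys]] := lab_onto comp_labelling (e := e) (s := false).
  by rewrite /present eA /= !attachedU (negbTE n1) (negbTE n2) orbT.
exists x; last first.
  by rewrite -xl -(edge_fiber _ comp_labelling).
rewrite inE; move: xl xs yl ys; rewrite !comp_signE /comp_label.
case: x => -[h|g] nd /=; last first.
  by move=> gl gs; move: nd; rewrite deletedY /lostY gl gs e1 n2.
move=> hl hs; case: y => -[h'|g] nd' /=.
  by move=> gl gs; move: nd'; rewrite deletedX /lostX gl gs e2 n3.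
move=> gl gs; apply/existsP; exists h; apply/existsP; exists g.
rewrite eqxx joinedE hl gl hs gs eqxx (negbTE n3) (negbTE n2) /=.
rewrite glue_virtual_legX ?hl // n3 glue_virtual_legY ?gl //.
Qed.

Lemma comp_block (x : comp_half X Y) : block x = 3 * cut_rank (comp_label x) +
  (if comp_label x \in A1 :&: A2 then 2 else if val x is inl _ then 1 else 0).
Proof.
rewrite /block /comp_label; case: (val x) => [h|g] /=.
  rewrite glue_out_rank; have -> : [exists o in gOut X, edge o == edge h] = (labX h \in A1 :&: A2).
    apply/existsP/idP => [[o /andP[]]|/gOut_onto[o oX E]].
      by rewrite glue_gOut (edge_eq HX) inE (lab_mem HX) => /andP[+ _] /eqP <-.
    by exists o; rewrite oX (edge_eq HX) E eqxx.
  by case: ifP.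
rewrite glue_in_rank; have -> : [exists o in gIn Y, edge o == edge g] = (labY g \in A1 :&: A2).
  apply/existsP/idP => [[o /andP[]]|/gIn_onto[o oX E]].
    by rewrite glue_gIn (edge_eq HY) inE (lab_mem HY) andbT => /andP[+ _] /eqP <-.
  by exists o; rewrite oX (edge_eq HY) E eqxx.
by case: ifP; rewrite ?addn0.
Qed.

(** An edge of the lower piece and one of the upper piece, neither on the cut,
are ordered as their numbers of preceding cut edges.  In case of equality the
upper one comes first, which is where [cut_between] enters. *)
Lemma between_rank a b : a \in A1 -> a \notin A2 -> b \in A2 -> b \notin A1 ->
  before a b = (cut_rank a < cut_rank b).
Proof.
move=> a1 a2 b2 b1; apply/idP/idP => [ab|].
  have [c + /andP[ac cb]] := cut_between a1 a2 b2 b1 ab; rewrite inE => /andP[c1 c2].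
  exact: leq_ltn_trans (cut_rank_le ac) (cut_rank_lt c1 c2 cb).
rewrite ltnNge; apply: contraNT => nab.
have [E|ne] := eqVneq a b; first by rewrite E b2 in a2.
by have := before_total HK ne; rewrite (negbTE nab) => /cut_rank_le.
Qed.

(** The number of the block of the composite order that contains an edge,
computed from the edge alone. *)
Definition slot e := 3 * cut_rank e +
  (if e \in A1 :&: A2 then 2 else if e \in A1 then 1 else 0).

Lemma slot_before e e' : e \in A -> e' \in A -> slot e < slot e' -> before e e'.
Proof.
move=> eA e'A lt; have [E|ne] := eqVneq e e'; first by rewrite E ltnn in lt.
case/orP: (before_total HK ne) => // b; exfalso.
move: lt (cut_rank_le b) (cut_rank_lt (e := e') (e' := e)).
rewrite /slot !inE; move: eA e'A; rewrite !inE b.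
have := @between_rank e' e.
case: (e \in A1); case: (e \in A2); case: (e' \in A1); case: (e' \in A2) => //=; rewrite b; try lia.
all: move=> H _ _ l1 l2; first [have := H isT isT isT isT; lia | have := l2 isT isT isT; lia].
Qed.

Lemma before_slot e e' : e \in A -> e' \in A -> before e e' -> slot e <= slot e'.
Proof.
move=> eA e'A b; rewrite leqNgt; apply/negP => /(slot_before e'A eA) b'.
by rewrite (before_asym HK b) in b'.
Qed.

Lemma comp_block_slot (x : comp_half X Y) : block x = slot (comp_label x).
Proof.
rewrite comp_block /slot; case: ifP => // c; congr (_ + _).
move: c; rewrite /comp_label inE; case: (val x) => [h|g] /=; first by rewrite (lab_mem HX).
by rewrite (lab_mem HY) andbT => ->.
Qed.

(** Within one block the composite compares edges only if they come from the
same factor; the only edges of a block seen from both sides are copies of a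
single cut edge, which is not before itself. *)
Lemma comp_half_prec (x y : comp_half X Y) :
  half_prec x y = before (comp_label x) (comp_label y).
Proof.
have mem z : comp_label z \in A.
  by rewrite /comp_label inE; case: (val z) => [h|g] /=; rewrite ?(lab_mem HX) ?(lab_mem HY) ?orbT.
have bxy := before_slot (mem x) (mem y).
rewrite /half_prec !comp_block_slot.
have [lt|gt|E] := ltngtP (slot (comp_label x)) (slot (comp_label y)) => /=.
- by rewrite (slot_before (mem x) (mem y)).
- by apply/esym/negP => /bxy; rewrite leqNgt gt.
(* Two edges in the same slot that come from different factors are the same cut edge. *)
have same e e' : e \in A1 -> e' \in A2 -> slot e = slot e' -> e = e'.
  move=> e1 e2' Es; apply: cut_rank_inj => //; move: Es; rewrite /slot !inE e1 e2' andbT /=;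
    by case: (e \in A2); case: (e' \in A1) => /=; lia.
move: E; rewrite /comp_label; clear mem bxy.
case: x => -[h|g] nx; case: y => -[h'|g'] ny /= E.
- by rewrite (lab_prec HX).
- by rewrite (same _ _ (lab_mem HX h) (lab_mem HY g') E) (before_irr HK).
- by rewrite (same _ _ (lab_mem HX h') (lab_mem HY g) (esym E)) (before_irr HK).
- by rewrite (lab_prec HY).
Qed.

Lemma comp_realizes : realizes S A comp_label.
Proof.
split; [exact: comp_labelling | exact: comp_vertices_glue | ].
move=> x y.
have labE (z t : half (comp X Y)) : t \in edge z -> comp_label t = comp_label z.
  by rewrite !inE => /orP[] /eqP-> //; rewrite (lab_inv comp_labelling).
apply/existsP/idP => [[x' /andP[/labE <- /existsP[y' /andP[/labE <-]]]]|b].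
  by rewrite comp_half_prec.
by exists x; rewrite set21 /=; apply/existsP; exists y; rewrite set21 comp_half_prec.
Qed.
End Gluing.

(** * Graphs whose vertices are closed under the involution are tensor products *)

Lemma vertex_unique (G : graph) (v w : {set half G}) h : is_graph G ->
  v \in vertices G -> w \in vertices G -> h \in v -> h \in w -> v = w.
Proof.
move=> HG vG wG hv hw; have [/and3P[_ t _] _ _] := HG.
apply/eqP/negPn/negP => ne; have /pred0P/(_ h) := trivIsetP t v w vG wG ne.
by rewrite /= hv hw.
Qed.

(** If every vertex is closed under the involution, its half-edges form a graph
on their own, and the whole graph is the disjoint union of these. *)
Section VertexGraph.
Variable G : graph.
Hypothesis HG : is_graph G.

Definition vertex_graph (v : {set half G}) : graph :=
  @Graph {h : half G | h \in v} [set [set: {h : half G | h \in v}]]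
    (fun x => insubd x (inv (val x))).

Hypothesis closed : forall v h, v \in vertices G -> h \in v -> inv h \in v.

Lemma val_inv_vertex v (x : half (vertex_graph v)) :
  v \in vertices G -> val (inv x) = inv (val x).
Proof. by move=> vG; rewrite val_insubd closed //; exact: valP. Qed.

Lemma vertex_graph_setT v : v \in vertices G ->
  val @: [set: half (vertex_graph v)] = v.
Proof.
move=> vG; apply/setP=> h; apply/imsetP/idP => [[x _ ->]|hv]; first exact: (valP x).
by exists (exist (fun h => h \in v) h hv).
Qed.

Lemma vertex_graph_graph v : v \in vertices G -> is_graph (vertex_graph v).
Proof.
move=> vG; have [/and3P[_ _ n0] invK virt] := HG; split.
- apply/and3P; split; first by rewrite /cover big_set1.
    by apply/trivIsetP => A B; rewrite !inE => /eqP-> /eqP->; rewrite eqxx.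
  rewrite inE; apply: contraNneq n0 => E.
  by have := vertex_graph_setT vG; rewrite -E imset0 => ->.
- by move=> x; apply: val_inj; rewrite !val_inv_vertex // invK.
- move=> w x; rewrite inE => /eqP-> _ _ nf.
  have Ev : v = edge (val x).
    apply: virt => //; [exact: (valP x) | rewrite closed //; exact: (valP x) | ].
    by rewrite -val_inv_vertex // (inj_eq val_inj).
  apply/esym/setP=> y; rewrite !inE -!(inj_eq val_inj) val_inv_vertex //.
  by have /setP/(_ (val y)) := Ev; rewrite (valP y) !inE => <-.
Qed.

Lemma vertex_graph_prime_or_unitary v :
  prime_graph (vertex_graph v) \/ unitary (vertex_graph v).
Proof.
have [vv|nv] := boolP (virtual_vertex [set: half (vertex_graph v)]).
  by right; exists setT.
left; split; first by rewrite cards1.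
by case=> w [vw E]; move: nv; rewrite (set1_inj E) vw.
Qed.

Lemma vertex_graph_unitary v : virtual_vertex v -> unitary (vertex_graph v).
Proof.
move=> /andP[vG /existsP[h /andP[nf /eqP E]]]; exists setT; split => //.
have hv : h \in v by rewrite E set21.
rewrite /virtual_vertex inE eqxx; apply/existsP; exists (exist (fun h => h \in v) h hv).
rewrite -(inj_eq val_inj) val_inv_vertex // nf; apply/eqP/esym/setP=> y.
rewrite !inE -!(inj_eq val_inj) val_inv_vertex //.
by have /setP/(_ (val y)) := E; rewrite (valP y) !inE => <-.
Qed.

(** The isomorphism with the tensor product is built from the product towards
the graph, one vertex at a time; this direction needs no case distinction on
half-edges. *)
Lemma tensor_embedding (s : seq {set half G}) :
  uniq s -> {subset s <= vertices G} ->
  let T := foldr tensor empty_graph [seq vertex_graph v | v <- s] in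
  exists g : half T -> half G,
    [/\ injective g, forall v x, v \in s -> x \in v -> exists y, g y = x,
        forall y, exists2 v, v \in s & g y \in v,
        {morph g : y / inv y} &
        forall w : {set half T}, (w \in vertices T) = (g @: w \in s)].
Proof.
elim: s => [|v s IH] /=.
  move=> _ _; exists (fun x : void => match x with end).
  by split=> [[]|//|[]|[]|w]; rewrite !inE.
case/andP=> vs us sub; have vG : v \in vertices G by apply: sub; rewrite inE eqxx.
have sG : {subset s <= vertices G} by move=> w ws; apply: sub; rewrite inE ws orbT.
have [g [ginj gonto gim gmorph gvert]] := IH us sG.
set T := foldr _ _ _ in g ginj gonto gim gmorph gvert *.
pose f (x : half (tensor (vertex_graph v) T)) : half G :=
  match x with inl x => val x | inr y => g y end.
have finj : injective f.
  have clash (x : half (vertex_graph v)) y : val x <> g y.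
    move=> E; have [w ws gw] := gim y; have := valP x; rewrite E => gv.
    by move: vs; rewrite (vertex_unique HG vG (sG _ ws) gv gw) ws.
  move=> [x|x] [y|y] /=.
  - by move/val_inj->.
  - by move/clash.
  - by move/esym/clash.
  - by move/ginj->.
exists f; split=> //.
- move=> w x; rewrite inE => /orP[/eqP-> xv|ws xw].
    by exists (inl (exist (fun h => h \in v) x xv)).
  by have [y Ey] := gonto _ _ ws xw; exists (inr y).
- case=> [x|y]; first by exists v; rewrite ?inE ?eqxx //; exact: (valP x).
  by have [w ws gw] := gim y; exists w; rewrite // inE ws orbT.
- by case=> [x|y] /=; [exact: val_inv_vertex | exact: gmorph].
have f_inl : f @: (inl @: [set: half (vertex_graph v)]) = v.
  by rewrite -imset_comp -[RHS](vertex_graph_setT vG); apply: eq_imset.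
have f_inr (u : {set half T}) : f @: (inr @: u) = g @: u.
  by rewrite -imset_comp; apply: eq_imset.
move=> w; rewrite !inE; apply/orP/orP => [[/imsetP[u]|/imsetP[u uT ->]]|[/eqP E|ws]].
- by rewrite inE => /eqP-> ->; left; rewrite f_inl.
- by right; rewrite f_inr -gvert.
- left; apply/imsetP; exists setT; rewrite ?inE //.
  by apply: (imset_inj finj); rewrite f_inl.
(* A vertex among the remaining ones is covered by g, hence comes from T. *)
right; apply/imsetP; exists (g @^-1: (f @: w)).
  rewrite gvert.
  suff -> : g @: (g @^-1: (f @: w)) = f @: w by [].
  apply/setP=> h; apply/imsetP/idP => [[y]|hw]; first by rewrite inE => ? ->.
  by have [y Ey] := gonto _ _ ws hw; exists y; rewrite ?inE Ey.
apply/setP=> x; rewrite -(mem_imset w x finj); case: x => [x|y].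
  rewrite [RHS](_ : _ = false); last by apply/imsetP => -[].
  apply/negP => xw; move: vs; rewrite (vertex_unique (h := val x) HG vG (sG _ ws)) ?ws //.
  exact: (valP x).
by rewrite (mem_imset _ _ inr_inj) inE.
Qed.

Lemma tensor_of_vertices (C : graph -> Prop) :
  (forall v, v \in vertices G -> C (vertex_graph v)) -> tensor_of C G.
Proof.
move=> HC.
have [|g [ginj gonto gim gmorph gvert]] := tensor_embedding (enum_uniq (vertices G)).
  by move=> v; rewrite mem_enum.
have gs h : exists y, g y = h.
  have [/and3P[/eqP cov _ _] _ _] := HG.
  have : h \in cover (vertices G) by rewrite cov inE.
  by case/bigcupP => v vG hv; apply: (gonto v); rewrite ?mem_enum.
have [f gf] := fin_all_exists gs.
have fg : cancel g f by move=> y; apply: ginj; rewrite gf.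
exists [seq vertex_graph v | v <- enum (vertices G)], f; split.
  move=> k; rewrite size_map => ks; rewrite (nth_map set0) //.
  have vG : nth set0 (enum (vertices G)) k \in vertices G by rewrite -mem_enum mem_nth.
  by split; [exact: vertex_graph_graph | exact: HC].
split.
- by exists g.
- by move=> h; apply: ginj; rewrite gmorph !gf.
move=> v; rewrite gvert mem_enum -imset_comp.
by rewrite (eq_imset (g := id)) ?imset_id.
Qed.

End VertexGraph.

Lemma elementary_of_closed (G : graph) : is_graph G ->
  (forall v h, v \in vertices G -> h \in v -> inv h \in v) -> elementary G.
Proof.
move=> HG closed; apply: tensor_of_vertices => // v _.
exact: vertex_graph_prime_or_unitary.
Qed.

Lemma invertible_of_virtual (G : graph) : is_graph G ->
  (forall v, v \in vertices G -> virtual_vertex v) -> invertible G.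
Proof.
move=> HG virt.
have closed v h : v \in vertices G -> h \in v -> inv h \in v.
  have [_ invK _] := HG.
  case/virt/andP=> _ /existsP[k /andP[_ /eqP->]]; rewrite !inE => /orP[] /eqP->.
    by rewrite eqxx orbT.
  by rewrite invK eqxx.
apply: tensor_of_vertices => // v /virt; exact: vertex_graph_unitary.
Qed.

(** No edge returns to v, so all half-edges at v are real legs and every vertex
is closed under the involution. *)
Lemma corolla_essential_prime (K : skeleton) (v : svert K) (A : {set sedge K})
    (X : pgraph) (lab : half X -> sedge K) :
  planar_skeleton K -> (forall e s, send e s = Some v -> e \in A) ->
  realizes [set v] A lab -> essential_prime X.
Proof.
move=> HK vA HX.
have SA e s : attached [set v] e s -> e \in A.
  by case/attachedP => w; rewrite inE => /eqP-> /vA.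
split; last by rewrite (card_real_vertices HK SA HX) cards1.
apply: elementary_of_closed; first exact: realizes_graph HX.
move=> w h; rewrite (lab_vertices HX) inE => /orP[]/imsetP[x]; last first.
  by move=> _ ->; rewrite !inE (lab_inv HX).
rewrite inE => /eqP-> ->; rewrite inE => /eqP E.
rewrite (_ : inv h = h) ?inE ?E //; apply/eqP; rewrite (fixedE HX).
apply/andP; split; first by apply/attachedP; exists v; rewrite ?inE.
apply/attachedP => -[u]; rewrite inE => /eqP-> E'.
by case: (sgn h) E E' => /= E E'; [apply: (send_noloop HK E) | apply: (send_noloop HK E')].
Qed.

(** * The skeleton of a planar graph *)

Section PlanarSkeleton.
Variable G : pgraph.
Hypothesis HG : is_planar G.
Implicit Types (h : half G).

Definition skeleton_of : skeleton :=
  @Skeleton {e : {set half G} | e \in edges G} {v : {set half G} | v \in real_vertices G}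
    (fun e s => [pick v : {v : {set half G} | v \in real_vertices G} |
       [exists h in val e, (sgn h == s) && (h \in val v)]])
    (fun e e' => prec (val e) (val e')).

Local Notation K := skeleton_of.

Let graphG : is_graph G. Proof. by case: HG. Qed.

Lemma edge_in_edges h : edge h \in edges G.
Proof. exact: imset_f. Qed.

Definition edge_label h : sedge K := exist (fun e => e \in edges G) _ (edge_in_edges h).

Lemma planar_invK : involutive (@inv G).
Proof. by have [[]] := HG. Qed.

Lemma planar_vertex_exists h : exists2 v, v \in vertices G & h \in v.
Proof.
have [[/and3P[/eqP cov _ _] _ _] _ _ _ _] := HG.
have : h \in cover (vertices G) by rewrite cov inE.
by case/bigcupP => v vG hv; exists v.
Qed.

Lemma edge_inv h : edge (inv h) = edge h.
Proof. by rewrite /edge planar_invK setUC. Qed.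

Lemma edge_mem h h' : h' \in edge h -> edge h' = edge h.
Proof. by rewrite !inE => /orP[] /eqP->; rewrite ?edge_inv. Qed.

Lemma edge_label_mem (e : sedge K) h : h \in val e -> e = edge_label h.
Proof.
move=> he; apply: val_inj; move: he; case: e => _ /= /imsetP[h' _ ->].
by move/edge_mem.
Qed.

Lemma edge_labelP (e : sedge K) : exists h, e = edge_label h.
Proof.
case: (e) => w i; have /imsetP[h _ E] := i; exists h; exact: val_inj.
Qed.

Lemma edge_label_inv h : edge_label (inv h) = edge_label h.
Proof. by apply: val_inj; rewrite /= edge_inv. Qed.

Lemma edge_label_eq h h' : edge_label h = edge_label h' -> h' = h \/ h' = inv h.
Proof.
move/(congr1 val) => /= E; have : h' \in edge h by rewrite E set21.
by rewrite !inE => /orP[] /eqP; [left|right].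
Qed.

Lemma planar_sgn_inv h : inv h != h -> sgn (inv h) = ~~ sgn h.
Proof. by have [_ [+ _] _ _ _] := HG; apply. Qed.

Lemma real_vertex_mem (v : svert K) : val v \in vertices G.
Proof. by have := valP v; rewrite inE => /andP[]. Qed.

Lemma edge_label_inj h h' : edge_label h = edge_label h' -> sgn h = sgn h' -> h = h'.
Proof.
move=> /edge_label_eq[-> //|E Es]; apply/eqP; apply: contraTT isT => ne.
have nf : inv h != h by rewrite -E eq_sym.
by move: Es; rewrite E planar_sgn_inv //; case: (sgn h).
Qed.

(** The only half-edge of the edge of h with the sign of h is h itself. *)
Lemma send_edge h (v : svert K) :
  (send (edge_label h) (sgn h) == Some v) = (h \in val v).
Proof.
rewrite /=; case: pickP => [u /existsP[h' /and3P[he /eqP sh hu]]|no].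
  have E : h' = h.
    by apply: edge_label_inj => //; apply: val_inj; exact: (edge_mem he).
  rewrite E in hu; apply/eqP/idP => [[<-] //|hv]; congr Some; apply: val_inj.
  exact: (vertex_unique graphG (real_vertex_mem u) (real_vertex_mem v) hu hv).
apply/esym/negP => hv; have := no v; move/existsP => []; exists h.
by rewrite set21 eqxx hv.
Qed.

Lemma send_fixed h : inv h = h -> send (edge_label h) (~~ sgn h) = None.
Proof.
move=> f; rewrite /=; case: pickP => // u /existsP[h' /and3P[]].
by rewrite !inE f orbb => /eqP->; case: (sgn h).
Qed.

(** A vertex containing one end of a virtual edge contains the other one, so the
two half-edges of an edge are both at real vertices or both at the same virtual
one ([at_real_inv]). *)
Definition at_real h := [exists v in real_vertices G, h \in v].

Lemma attached_edge h : attached setT (edge_label h) (sgn h) = at_real h.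
Proof.
apply/attachedP/existsP => [[v _ /eqP]|[w /andP[wR hw]]].
  by rewrite send_edge => hv; exists (val v); rewrite hv (valP v).
exists (exist _ w wR : svert K); rewrite ?inE //.
by apply/eqP; rewrite send_edge.
Qed.

Lemma virtual_vertex_edge v h : virtual_vertex v -> h \in v -> v = edge h /\ inv h != h.
Proof.
case/andP=> vG /existsP[k /andP[nf /eqP->]] hk; rewrite (edge_mem hk); split=> //.
by move: hk; rewrite !inE => /orP[] /eqP->; rewrite ?planar_invK // eq_sym.
Qed.

Lemma at_real_virtual h : ~~ at_real h -> virtual_vertex (edge h).
Proof.
move=> nr; have [v vG hv] := planar_vertex_exists h.
have [vv|nv] := boolP (virtual_vertex v); first by have [<-] := virtual_vertex_edge vv hv.
by case/existsP: nr; exists v; rewrite hv inE vG nv.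
Qed.

Lemma virtual_at_real h : virtual_vertex (edge h) -> ~~ at_real h.
Proof.
move=> vv; apply/existsP => -[w /andP[]]; rewrite inE => /andP[wG nw] hw.
have eG : edge h \in vertices G by case/andP: vv.
by move: nw; rewrite -(vertex_unique graphG eG wG _ hw) ?vv // set21.
Qed.

Lemma at_real_inv h : at_real (inv h) = at_real h.
Proof.
have E k : at_real k = ~~ virtual_vertex (edge k).
  apply/idP/idP; first by apply: contraL; exact: virtual_at_real.
  by apply: contraNT; exact: at_real_virtual.
by rewrite !E edge_inv.
Qed.

Lemma at_real_fixed h : inv h = h -> at_real h.
Proof.
move=> f; apply: contraT => /at_real_virtual vv.
by have [_] := virtual_vertex_edge vv (set21 _ _); rewrite f eqxx.
Qed.

Lemma attached_edge_neg h :
  attached setT (edge_label h) (~~ sgn h) = at_real h && (inv h != h).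
Proof.
have [f|nf] := eqVneq (inv h) h; first by rewrite andbF /attached send_fixed.
by rewrite -planar_sgn_inv // -edge_label_inv attached_edge at_real_inv andbT.
Qed.

Lemma present_edge_neg h :
  present setT setT (edge_label h) (~~ sgn h) = (inv h != h).
Proof.
rewrite /present inE /= negbK attached_edge attached_edge_neg.
by have [/at_real_fixed->|_] := eqVneq; case: at_real.
Qed.

Lemma planar_realizes : realizes setT setT edge_label.
Proof.
have lbl : labelling setT setT edge_label.
  split.
  - exact: edge_label_inj.
  - move=> h; rewrite /present inE attached_edge attached_edge_neg.
    by case: at_real.
  - move=> e s; have [h ->] := edge_labelP e; have [<-|ne] := eqVneq (sgn h) s; first by exists h.
    have -> : s = ~~ sgn h by case: (sgn h) s ne => -[].
    by rewrite present_edge_neg => nf; exists (inv h); rewrite edge_label_inv planar_sgn_inv.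
  - exact: edge_label_inv.
  - move=> h; rewrite present_edge_neg; have [->|nf] := eqVneq; rewrite ?addbF //.
    by rewrite addbT planar_sgn_inv.
split=> //.
have starE (v : svert K) : star edge_label v = val v.
  by apply/setP=> h; rewrite inE send_edge.
have isoE h : edge_label h \in isolated setT setT = virtual_vertex (edge h).
  rewrite (isolatedE _ _ _ (sgn h)) inE attached_edge attached_edge_neg /=.
  have [vv|nv] := boolP (virtual_vertex _); first by rewrite (negbTE (virtual_at_real vv)).
  by rewrite (contraNT (@at_real_virtual h) nv).
apply/setP=> w; rewrite inE; apply/idP/orP => [wG|[]/imsetP[x xP ->]].
- have [vw|nv] := boolP (virtual_vertex w); [right|left]; last first.
    have wR : w \in real_vertices G by rewrite inE wG.
    by apply/imsetP; exists (exist _ w wR : svert K); rewrite ?starE ?inE.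
  have [_ /existsP[h /andP[nf /eqP E]]] := andP vw.
  by apply/imsetP; exists (edge_label h); rewrite -?(edge_fiber _ lbl) ?isoE -?E.
- by rewrite starE real_vertex_mem.
- move: xP; have [h ->] := edge_labelP x; rewrite isoE -(edge_fiber _ lbl).
  by case/andP.
Qed.

Lemma step_follows (e e' : sedge K) : step e e' -> follows (val e) (val e').
Proof.
have [h Eh] := edge_labelP e; have [h' Eh'] := edge_labelP e'.
case/andP=> /eqP; case E: (send e true) => [v|//] E' _.
rewrite /follows (valP e) (valP e'); apply/existsP; exists (val v).
rewrite /is_target /is_source real_vertex_mem /=; apply/andP; split.
  move: E; rewrite /=; case: pickP => // u /existsP[k /and3P[k1 /eqP k2 k3]] [<-].
  by apply/existsP; exists k; rewrite k1 k2.
move/esym: E'; rewrite /=; case: pickP => // u /existsP[k /and3P[k1 /eqP k2 k3]] [<-].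
by apply/existsP; exists k; rewrite k1 k2.
Qed.

Lemma connect_reaches (e e' : sedge K) : connect (@step K) e e' -> reaches (val e) (val e').
Proof.
case/connectP => p; elim: p e => [|x p IH] e /=; first by move=> _ ->; exact: connect0.
case/andP=> /step_follows st pp /(IH _ pp); exact: connect_trans (connect1 st).
Qed.

(** A virtual edge follows itself, but this does not connect it to any other
edge, so steps through virtual vertices can be dropped. *)
Lemma reaches_connect (e e' : sedge K) : reaches (val e) (val e') -> connect (@step K) e e'.
Proof.
case/connectP => p; elim: p e => [|x p IH] e /=; first by move=> _ /val_inj->; exact: connect0.
case/andP=> st pp last_p; have [_ xG _] := and3P st.
apply: (connect_trans _ (IH (exist _ x xG) pp last_p)) => /= {IH pp last_p}.
case/and3P: st => _ _ /existsP[w /andP[/andP[wG /existsP[h /and3P[he sh hw]]]]].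
case/andP=> _ /existsP[k /and3P[kx sk kw]].
rewrite (edge_label_mem he) (@edge_label_mem (exist _ x xG) k kx).
have [vw|nv] := boolP (virtual_vertex w).
  rewrite (_ : edge_label k = edge_label h) ?connect0 //; apply: val_inj => /=.
  by have [<- _] := virtual_vertex_edge vw hw; have [-> _] := virtual_vertex_edge vw kw.
have wR : w \in real_vertices G by rewrite inE wG.
apply: connect1; rewrite /step.
have -> : send (edge_label h) true = Some (exist _ w wR : svert K).
  by apply/eqP; rewrite -sh send_edge.
have -> : send (edge_label k) false = Some (exist _ w wR : svert K).
  by apply/eqP; rewrite -(negbTE sk) send_edge.
by rewrite eqxx.
Qed.

Lemma skeleton_of_planar : planar_skeleton K.
Proof.
have [_ [_ inout] [irr trans total] ax1 ax2] := HG; split.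
- by move=> e; exact: irr (valP e).
- by move=> e1 e2 e3; apply: trans; exact: valP.
- by move=> e e' ne; apply: total; rewrite ?(inj_eq val_inj) //; exact: valP.
- move=> v s; have [i o] := inout _ (real_vertex_mem v).
  have [h hv <-] : exists2 h, h \in val v & sgn h = s.
    case: s; [case/set0Pn: i | case/set0Pn: o] => h; rewrite inE => /andP[hv sh];
      by exists h; rewrite // (negbTE sh).
  by exists (edge_label h); apply/eqP; rewrite send_edge.
- move=> e v a b; have [h Eh] := edge_labelP e.
  have [m1 m2] : send e (sgn h) = Some v /\ send e (~~ sgn h) = Some v by case: (sgn h).
  have nf : inv h != h by apply: contraPneq m2 => f; rewrite Eh send_fixed.
  have hv : h \in val v by rewrite -send_edge -Eh m1.
  have ihv : inv h \in val v.
    by rewrite -send_edge edge_label_inv planar_sgn_inv // -Eh m2.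
  have [[_ _ virt] _ _ _ _] := HG; have := valP v; rewrite inE => /andP[vG /negP[]].
  rewrite /virtual_vertex vG; apply/existsP; exists h; rewrite nf; apply/eqP.
  exact: virt.
- move=> e e' ne /connect_reaches; apply: ax1; rewrite ?(inj_eq val_inj) //; exact: valP.
- move=> e1 e2 e3 /connect_reaches r b1 b2.
  by case/orP: (ax2 _ _ _ (valP e1) (valP e2) (valP e3) r b1 b2) => /reaches_connect ->;
    rewrite ?orbT.
Qed.

End PlanarSkeleton.

(** * Splitting off a top vertex *)

Section Decomposition.
Variable K : skeleton.
Hypothesis HK : planar_skeleton K.
Implicit Types (e a b : sedge K) (v : svert K) (S : {set svert K}).

Definition lower S := forall e v, attached S e true -> send e false = Some v -> v \in S.

Definition below S : {set sedge K} := [set e | (send e false == None) || attached S e false].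

Lemma lower_below S e : lower S -> attached S e true -> e \in below S.
Proof.
move=> low a; rewrite inE; case E: (send e false) => [v|//]; apply/orP; right.
by apply/attachedP; exists v; rewrite ?(low _ _ a E).
Qed.

Lemma attached_below S e s : lower S -> attached S e s -> e \in below S.
Proof. by move=> low; case: s => a; [exact: lower_below | rewrite inE a orbT]. Qed.

(** Follow the path backwards: its edges end in predecessors of a vertex of S. *)
Lemma connect_lower S e e' : lower S ->
  connect (@step K) e e' -> attached S e' true -> attached S e true.
Proof.
move=> low /connectP[p + ->]; elim: p e => //= x p IH e /andP[/andP[/eqP E ne] pp].
move/(IH _ pp) => a; case E': (send e true) ne => [v|//] _; apply/attachedP; exists v => //.
by apply: low a _; rewrite -E.
Qed.

Lemma connect_first e e' : connect (@step K) e e' -> e != e' ->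
  exists2 x, step e x & connect (@step K) x e'.
Proof.
case/connectP => -[|x p] /= => [_ -> /eqP //|/andP[st pp] -> _].
by exists x => //; apply/connectP; exists p.
Qed.

Lemma connect_last e e' : connect (@step K) e e' -> e != e' ->
  exists2 x, connect (@step K) e x & step x e'.
Proof.
case/connectP => p; elim/last_ind: p => [_ -> /eqP //|p x _].
rewrite rcons_path last_rcons => /andP[pp st] -> _.
by exists (last e p) => //; apply/connectP; exists p.
Qed.

Section TopVertex.
Variables (S : {set svert K}) (v : svert K).
Hypothesis (lowS : lower S) (vS : v \in S).
Hypothesis top : forall e, send e false = Some v -> ~~ attached S e true.

Lemma top_lower : lower (S :\ v).
Proof.
move=> e u /attachedP[w]; rewrite !inE => /andP[nw wS] E F.
have a : attached S e true by apply/attachedP; exists w.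
rewrite (lowS a F) andbT; apply: contraTneq a => Eu.
by apply: top; rewrite F Eu.
Qed.

Definition above : {set sedge K} := [set e in below S | ~~ attached (S :\ v) e true].

Lemma attached_top e s : attached [set v] e s -> send e s = Some v.
Proof. by case/attachedP => u; rewrite inE => /eqP->. Qed.

Lemma attachedD1 e s u : send e s = Some u -> attached (S :\ v) e s = (u != v) && (u \in S).
Proof. by rewrite /attached => ->; rewrite !inE. Qed.

Lemma top_above e s : send e s = Some v -> e \in above.
Proof.
move=> E; have a : attached S e s by apply/attachedP; exists v.
rewrite inE (attached_below lowS a); case: s E a => E a; first by rewrite (attachedD1 E) eqxx.
apply: contra (top E) => /attachedP[u]; rewrite !inE => /andP[_ uS] F.
by apply/attachedP; exists u.
Qed.

(** Behind v the path continues along an edge not ending in S.  If it went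
further and its last edge started in S, then this edge would end in S by
[connect_lower]. *)
Lemma connect_top e e' : send e true = Some v -> e' \in below S -> e != e' ->
  connect (@step K) e e' -> send e' false = Some v.
Proof.
move=> E; rewrite inE => e'b ne /connect_first-/(_ ne)[x /andP[/eqP st _] c].
have [<-|nx] := eqVneq x e'; first by rewrite -st.
have [y cxy /andP[/eqP E1 n1]] := connect_last c nx.
have a : attached S y true.
  rewrite /attached E1; move: e'b n1; rewrite /attached E1.
  by case: (send e' false).
by have /negP[] := @top x (etrans (esym st) E); exact: (connect_lower lowS cxy a).
Qed.

(** Convexity of the upper piece: i and o being an edge into v and one out of v,
an edge between them is reached from i, hence leaves v, or reaches o through v,
hence ends in S and, being above the cut, in v. *)
Lemma above_convex e1 e2 e3 : send e1 true = Some v -> send e2 false = Some v ->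
  e3 \in above -> before e1 e3 -> before e3 e2 ->
  send e3 true = Some v \/ send e3 false = Some v.
Proof.
move=> E1 E2; rewrite inE => /andP[e3b n3] b1 b2.
have c12 : connect (@step K) e1 e2 by apply: connect1; rewrite /step E1 E2 eqxx.
case/orP: (connect_convex HK c12 b1 b2) => c.
  right; apply: (connect_top E1 e3b _ c); apply: contraTneq b1 => ->.
  by rewrite (before_irr HK).
have ne : e3 != e2 by apply: contraTneq b2 => ->; rewrite (before_irr HK).
have [x cx /andP[/eqP st _]] := connect_last c ne.
have ax : attached S x true by apply/attachedP; exists v; rewrite // st.
have /attachedP[u uS Eu] := connect_lower lowS cx ax.
left; move: n3; rewrite (attachedD1 Eu) uS andbT negbK => /eqP <-; exact: Eu.
Qed.

Lemma below_sub e : e \in below (S :\ v) -> e \in below S.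
Proof.
rewrite !inE => /orP[->//|/attachedP[u]]; rewrite !inE => /andP[_ uS] E.
by apply/orP; right; apply/attachedP; exists u.
Qed.

Lemma below_cut e : e \in below (S :\ v) -> (e \in above) = ~~ attached (S :\ v) e true.
Proof. by move=> /below_sub eb; rewrite inE eb. Qed.

Lemma below_above e : e \in below S ->
  (e \in below (S :\ v)) = ~~ attached [set v] e false.
Proof.
rewrite !inE /attached; case: (send e false) => [u|//] /=.
by rewrite !inE => ->; rewrite andbT.
Qed.

(** The edge b leaves v.  Any edge i into v is in the cut and separates a from
b, unless i precedes a; then convexity for i, a, b applies. *)
Lemma below_above_between a b : a \in below (S :\ v) -> a \notin above ->
  b \in above -> b \notin below (S :\ v) -> before a b ->
  exists2 c, c \in below (S :\ v) :&: above & before a c && before c b.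
Proof.
move=> a1 a2 b2 b1 ab.
have {}a2 : attached (S :\ v) a true by move: a2; rewrite below_cut // negbK.
have bS : b \in below S by move: b2; rewrite inE => /andP[].
have Eb : send b false = Some v by apply: attached_top; move: b1; rewrite below_above // negbK.
have cut c : send c true = Some v -> c \in below (S :\ v) :&: above.
  move=> Ec; rewrite inE (top_above Ec) andbT below_above; last first.
    by apply: (@attached_below S c true) => //; apply/attachedP; exists v.
  by apply/negP => /attached_top; exact: (send_noloop HK Ec).
have before_b c : send c true = Some v -> before c b.
  move=> Ec; apply: (connect_before HK); last by apply: connect1; rewrite /step Ec Eb eqxx.
  by apply: contra_eq_neq Ec => ->; apply/eqP => /(send_noloop HK).
have ne_a c : send c true = Some v -> a != c.
  by move=> Ec; apply: contraTneq a2 => ->; rewrite (attachedD1 Ec) eqxx.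
have [i Ei] := send_onto HK v true.
case/orP: (before_total HK (ne_a _ Ei)) => [ai|ia].
  by exists i; rewrite ?cut // ai before_b.
have ci : connect (@step K) i b by apply: connect1; rewrite /step Ei Eb eqxx.
case/orP: (connect_convex HK ci ia ab) => c.
  (* If i reaches a, then a leaves v, and is not below S minus v. *)
  have := connect_top Ei (below_sub a1) _ c; rewrite eq_sym => /(_ (ne_a _ Ei)) E.
  by move: a1; rewrite inE E (attachedD1 E) eqxx.
(* If a reaches b, then the last edge x of the path before b enters v. *)
have ne : a != b by apply: contraTneq ab => ->; rewrite (before_irr HK).
have [x cx /andP[/eqP st _]] := connect_last c ne.
rewrite Eb in st; exists x; rewrite ?cut // before_b // andbT.
exact: (connect_before HK (ne_a _ st) cx).
Qed.

Lemma glue_top (X Y : pgraph) (labX : half X -> sedge K) (labY : half Y -> sedge K) :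
  realizes (S :\ v) (below (S :\ v)) labX -> realizes [set v] above labY ->
  composable X Y /\ exists lab : half (comp X Y) -> sedge K, realizes S (below S) lab.
Proof.
move=> HX HY.
have SA1 e s : attached (S :\ v) e s -> e \in below (S :\ v).
  exact: attached_below top_lower.
have SA2 e s : attached [set v] e s -> e \in above by move=> /attached_top/top_above.
have cut2 e : e \in above -> (e \in below (S :\ v)) = ~~ attached [set v] e false.
  by rewrite inE => /andP[eb _]; exact: below_above.
have ES : (S :\ v) :|: [set v] = S by rewrite setUC setD1K.
have EA : below (S :\ v) :|: above = below S.
  apply/setP=> e; rewrite in_setU; apply/orP/idP => [[/below_sub//|]|eb].
    by rewrite inE => /andP[].
  have [?|] := boolP (e \in below (S :\ v)); first by left.
  by rewrite below_above // negbK => /attached_top/top_above; right.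
split; first exact: (glue_composable HK below_cut cut2 HX HY).
exists (comp_label labX labY); rewrite -[in below S]EA -[X in realizes X]ES.
exact: (comp_realizes HK SA1 SA2 below_cut cut2 below_above_between HX HY).
Qed.
End TopVertex.

Lemma exists_top S : S != set0 ->
  exists2 v, v \in S & forall e, send e false = Some v -> ~~ attached S e true.
Proof.
case/set0Pn => u uS; have [e0 E0] := send_onto HK u true.
have a0 : attached S e0 true by apply/attachedP; exists u.
(* The number of preceding edges turns the last edge into an arg max. *)
pose r e := #|[set c | before c e]|.
have [e ea emax] := @arg_maxnP _ e0 (fun e => attached S e true) r a0.
have /attachedP[v vS Ev] := ea; exists v => // o Eo; apply/negP => oa.
have b : before e o.
  apply: (connect_before HK); last by apply: connect1; rewrite /step Ev Eo eqxx.
  by apply/eqP => E; case: (send_noloop HK Ev); rewrite E.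
have := emax o oa; rewrite /geq /= leqNgt => /negP[]; apply: proper_card; apply/properP; split.
  by apply/subsetP=> c; rewrite !inE => ce; exact: (before_trans HK ce b).
by exists e; rewrite !inE ?b ?(before_irr HK).
Qed.

(** When v is the only vertex of S, every edge below S is above the cut, so the
upper piece is already the whole of S. *)
Lemma lower_decomposition (D : pgraph) n S : lower S -> #|S| = n.+1 ->
  exists (Gs : seq pgraph) (G' : pgraph) (lab : half G' -> sedge K),
    [/\ size Gs = n.+1,
        forall k, k < n.+1 -> is_planar (nth D Gs k) /\ essential_prime (nth D Gs k),
        iterated_comp Gs G' & realizes S (below S) lab].
Proof.
elim: n S => [|n IH] S lowS cS.
all: have [|v vS top] := @exists_top S; first by rewrite -card_gt0 cS.
all: pose Y := model [set v] (above S v).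
all: have HY := @model_realizes K [set v] (above S v).
all: have vA e s : send e s = Some v -> e \in above S v by exact: top_above.
all: have planY : is_planar Y := corolla_planar HK vA (above_convex lowS vS top) HY.
all: have primeY : essential_prime Y := corolla_essential_prime HK vA HY.
  have ES : S = [set v].
    by apply/eqP; rewrite eq_sym eqEcard sub1set vS cards1 cS.
  exists [:: Y], Y, (fun x : half Y => (val x).1); split=> //; first by case.
    exact: IterOne.
  rewrite {1}ES (_ : below S = above S v) //; apply/setP=> e; rewrite [in RHS]inE.
  by rewrite ES setDv /attached; case: (send e true) => [u|]; rewrite ?inE andbT.
have [|Gs [G' [lab [sz good it HG']]]] := IH (S :\ v) (top_lower lowS top).
  by move: cS; rewrite (cardsD1 v) vS => -[].
have [co [lab' HR]] := glue_top lowS vS top HG' HY.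
exists (rcons Gs Y), (comp G' Y), lab'; split=> //.
- by rewrite size_rcons sz.
- move=> k; rewrite ltnS nth_rcons sz leq_eqVlt => /orP[/eqP->|lt]; first by rewrite ltnn eqxx.
  by rewrite lt; exact: good.
- exact: IterRcons.
Qed.
End Decomposition.

Theorem theorem3p5p8 (G : pgraph) (n : nat) :
  is_planar G -> ~ invertible G -> #|real_vertices G| = n ->
  exists (Gs : seq pgraph) (G' : pgraph),
    size Gs = n /\
    (forall k, k < n ->
       is_planar (nth G Gs k) /\ essential_prime (nth G Gs k)) /\
    iterated_comp Gs G' /\ planar_iso G G'.
Proof.
move=> HG ninv cn.
case: n cn => [/cards0_eq r0|n cn].
  case: ninv; apply: invertible_of_virtual; first by case: HG.
  move=> v vG; apply: contraT => nv.
  by have := in_set0 v; rewrite -r0 inE vG nv.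
have HK := skeleton_of_planar HG; have HR := planar_realizes HG.
have low : lower [set: svert (skeleton_of G)] by move=> e v _ _; rewrite inE.
have [|Gs [G' [lab [sz good it HR']]]] := lower_decomposition HK G (n := n) low.
  by rewrite cardsT card_sig -cn; apply: eq_card => v.
have E : below [set: svert (skeleton_of G)] = setT.
  by apply/setP=> e; rewrite !inE /attached; case: (send e false) => [v|]; rewrite ?inE.
rewrite E in HR'; exists Gs, G'; do !split=> //.
exact: realizations_iso HR HR'.
Qed.
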